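(* For the infinite server G/G/$\infty$ queue with inter-generation time $X\sim F_X$, $\mathbb{E}[X]=1/\lambda$, and service time $S\sim F_S$, $\mathbb{E}[S]=1/\mu$, $\lambda<\mu$, the average age is lower-bounded by $$A^{\mathrm{ave}}_{\mathrm{G/G/}\infty}(F_S)\ \ge\ \frac12\frac{\mathbb{E}[X^2]}{\mathbb{E}[X]}.$$ Further, for fixed $F_X$ and $\mu$, the lower bound is achieved asymptotically, i.e. $A^{\mathrm{ave}}_{\mathrm{G/G/}\infty}(F_S)\to\frac12\frac{\mathbb{E}[X^2]}{\mathbb{E}[X]}$, for: 1. Pareto distributed service, $F_S(s)=1-(\theta(\alpha)/s)^{\alpha}$ for $s\ge\theta(\alpha)$ and $F_S(s)=0$ otherwise, with $\theta(\alpha)=\frac1\mu\left(1-\frac1\alpha\right)$, $\alpha>1$, as $\alpha\to1$; 2. Log-normal distributed service, $S=\exp\{-\log\mu-\frac{\sigma^2}{2}+\sigma N\}$ with $N\sim\mathcal{N}(0,1)$, $\sigma>0$, as $\sigma\to+\infty$; 3. Weibull distributed service, $F_S(s)=1-e^{-(s/\beta)^{\kappa}}$ for $s\ge0$, with $\beta=[\mu\Gamma(1+1/\kappa)]^{-1}$, $\kappa>0$, as $\kappa\to0$.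
   Context: Update packets $i=1,2,\dots$ are generated at times $t_1<t_2<\cdots$ of a renewal process with i.i.d. inter-generation times distributed as $X$. In the G/G/$\infty$ queue each generated packet is immediately put into service at its own new server; service times $S_i$ are i.i.d. with distribution $F_S$, independent of the generation process, so packet $i$ reaches the destination at time $t_i'=t_i+S_i$. With $\mathcal{P}(t)$ the set of packets received up to time $t$, the age is $A(t)=\min_{i\in\mathcal{P}(t)}(t-t_i)$ and the average age is $A^{\mathrm{ave}}=\limsup_{T\to\infty}\mathbb{E}\left[\frac1T\int_0^TA(t)\,dt\right]$, denoted $A^{\mathrm{ave}}_{\mathrm{G/G/}\infty}(F_S)$ for this queue. *)

(* Defs.v *)
From HB Require Import structures.
From mathcomp Require Import all_boot all_order all_algebra.
From mathcomp Require Import all_classical all_reals all_analysis.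

Set Implicit Arguments.
Unset Strict Implicit.
Unset Printing Implicit Defensive.

Import Order.TTheory GRing.Theory Num.Theory.
Import numFieldNormedType.Exports.

Local Open Scope classical_set_scope.
Local Open Scope ring_scope.

Section independence.
Context (d : measure_display) (T : measurableType d) (R : realType).
Variable P : probability T R.

Definition mutually_independent (Y : nat -> {RV P >-> R}) : Prop :=
  forall (J : seq nat) (B : nat -> set R), uniq J ->
    (forall j, measurable (B j)) ->
    P (\bigcap_(j in [set` J]) (Y j @^-1` B j)) =
    (\prod_(j <- J) P (Y j @^-1` B j))%E.

Definition identically_distributed (Y : nat -> {RV P >-> R})
    (F : probability R R) : Prop :=
  forall (i : nat) (B : set R), measurable B -> distribution P (Y i) B = F B.

Definition sigma_generated (Y : nat -> {RV P >-> R}) : set (set T) :=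
  <<s \bigcup_i preimage_set_system setT (Y i) measurable >>.

Definition independent_processes (Y Z : nat -> {RV P >-> R}) : Prop :=
  forall A B : set T, sigma_generated Y A -> sigma_generated Z B ->
    P (A `&` B) = (P A * P B)%E.

End independence.

(* The average age depends on the underlying probability space only through
   the two laws, so a queue is any realization of them. Packets are numbered
   from 0; [interarrival 0] is the generation time of the first one. *)
Record GGinf_queue (R : realType) (FX FS : probability R R) := GGinfQueue {
  qdisp : measure_display;
  qspace : measurableType qdisp;
  qprob : probability qspace R;
  interarrival : nat -> {RV qprob >-> R};
  service : nat -> {RV qprob >-> R};
  interarrival_indep : mutually_independent interarrival;
  interarrival_law : identically_distributed interarrival FX;
  interarrival_gt0 : {ae qprob, forall w, forall i, 0 < interarrival i w};
  service_indep : mutually_independent service;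
  service_law : identically_distributed service FS;
  service_ge0 : {ae qprob, forall w, forall i, 0 <= service i w};
  interarrival_service_indep : independent_processes interarrival service
}.

Section age.
Context (R : realType) (FX FS : probability R R) (Q : GGinf_queue FX FS).

Definition generation_time (i : nat) (w : qspace Q) : R :=
  \sum_(k < i.+1) interarrival Q k w.

Definition reception_time (i : nat) (w : qspace Q) : R :=
  generation_time i w + service Q i w.

Definition received (t : R) (w : qspace Q) : set nat :=
  [set i | reception_time i w <= t].

(* Almost surely the set of received packets is finite, so the infimum is a
   minimum. Before the first reception the age is that of a system which was
   up to date at time 0. *)
Definition age (t : R) (w : qspace Q) : \bar R :=
  if received t w == set0 then t%:E
  else ereal_inf [set (t - generation_time i w)%:E | i in received t w].

Definition time_averaged_age (T : R) (w : qspace Q) : \bar R :=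
  ((T^-1)%:E * \int[lebesgue_measure]_(t in `[0%R, T]) age t w)%E.

Definition average_age : \bar R :=
  limf_esup (fun T : R => \int[qprob Q]_w time_averaged_age T w)%E +oo%R.

End age.

Definition age_bound (R : realType) (FX : probability R R) : \bar R :=
  ((2^-1)%:E * ('E_FX[fun x : R => (x ^+ 2)%R] / 'E_FX[fun x : R => x]))%E.

Section service_families.
Context (R : realType).

Definition has_cdf (F : probability R R) (G : R -> R) : Prop :=
  forall s : R, F `]-oo, s]%classic = (G s)%:E.

Definition pareto_cdf (mu alpha s : R) : R :=
  let theta := mu^-1 * (1 - alpha^-1) in
  if theta <= s then 1 - (theta / s) `^ alpha else 0.

Definition is_lognormal (F : probability R R) (mu sigma : R) : Prop :=
  forall B : set R, measurable B ->
    F B = normal_prob (0 : R) 1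
      [set n : R | B (expR (- ln mu - sigma ^+ 2 / 2 + sigma * n))].

Definition Gamma (z : R) : R :=
  (\int[lebesgue_measure]_(t in `]0%R, +oo[) (t `^ (z - 1) * expR (- t)))%R.

Definition weibull_cdf (mu kappa s : R) : R :=
  let beta := (mu * Gamma (1 + kappa^-1))^-1 in
  if 0 <= s then 1 - expR (- (s / beta) `^ kappa) else 0.

End service_families.

(* Main.v *)
(* Both halves of the proof count generation intervals. Let t_i be the sum of
   the first i inter-generation times X_0, X_1, ... and let T be a horizon.

   Lower bound: on [t_i, t_(i+1)[ the age is at least t - t_i, so its integral
   over [0, T] is at least the sum of X_i^2 / 2 over the complete intervals, and
   hence at least the sum of X_i^2 / 2 1(X_i <= b) 1(t_i <= T) minus b^2 / 2.
   As X_i is independent of t_i, the expectation of that sum is a product, and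
   the mean number of i with t_i <= T is at least about T / E X because
   sum X_i 1(t_i <= T) >= T. Then T, and after it b, tends to infinity.

   Upper bound: call a packet late when its service exceeds e, and let
   q = P(S > e). On [t_i + e, t_(i+1) + e[ the age is at most t - t_i + B_i,
   where the backlog B_i is the sum of the X_j such that all of the packets
   j, ..., i - 1 are late; by independence the mean backlog brings in a
   geometric series in q. The mean number of i with t_i <= T is at most
   (T + b) / E min(X, b). Altogether the average age is at most
   e + E X^2 / (2 E X) + q / (1 - q) E X. In each of the three families the
   service times tend to 0 in probability although their mean is fixed, so
   q tends to 0 for every e.

   The age is not known to be measurable. Its integrals are therefore only
   compared with integrals of measurable functions. *)

Require Import Defs.
From HB Require Import structures.
From mathcomp Require Import all_boot all_order all_algebra.
From mathcomp Require Import all_classical all_reals all_analysis.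
From mathcomp Require Import measurable_realfun lra ring.

Set Implicit Arguments.
Unset Strict Implicit.
Unset Printing Implicit Defensive.

Import Order.TTheory GRing.Theory Num.Theory.
Import numFieldNormedType.Exports.

Local Open Scope classical_set_scope.
Local Open Scope ring_scope.

(** * Comparison of integrals of possibly non-measurable functions *)

Section nonmeasurable_integrands.
Local Open Scope ereal_scope.
Context d (T : measurableType d) (R : realType) (mu : {measure set T -> \bar R}).
Implicit Types f g : T -> \bar R.

(** The integral of a nonnegative function is a supremum over the simple functions below it, which
    is monotone without any measurability. *)
Lemma integral_le_nonmeasurable D f g : (forall x, D x -> 0 <= f x) ->
  (forall x, D x -> f x <= g x) ->
  \int[mu]_(x in D) f x <= \int[mu]_(x in D) g x.
Proof.
move=> f0 fg; have g0 x : D x -> 0 <= g x.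
  by move=> Dx; exact: le_trans (f0 _ Dx) (fg _ Dx).
rewrite integral_mkcond [leRHS]integral_mkcond !ge0_integralTE//; last 2 first.
- exact: erestrict_ge0.
- exact: erestrict_ge0.
apply: ereal_sup_le => _ [h hf <-]; exists h => // x.
exact: le_trans (hf x) (lee_restrict fg x).
Qed.

Lemma integral_infty_null (N : set T) : measurable N -> mu N = 0 ->
  \int[mu]_x ((cst +oo) \_ N) x = 0.
Proof. by move=> mN N0; rewrite -integral_mkcond integral_cst// N0 mule0. Qed.

(** Adding to [g] a function infinite on the exceptional null set makes it dominate the positive
    part of [f] everywhere without changing its integral. *)
Lemma ae_integral_le f g : measurable_fun [set: T] g -> (forall x, 0 <= g x) ->
  {ae mu, forall x, f x <= g x} -> \int[mu]_x f x <= \int[mu]_x g x.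
Proof.
move=> mg g0 [N [mN N0 fgN]].
have infN0 x : 0 <= ((cst (+oo : \bar R)) \_ N) x.
  by rewrite patchE; case: ifPn => _; [exact: le0y|exact: lexx].
have le_pos : \int[mu]_x f x <= \int[mu]_x f^\+ x.
  rewrite integralE -[leRHS]sube0; apply: leeB => //; exact: integral_ge0.
apply: (le_trans le_pos).
rewrite -[leRHS]adde0 -(integral_infty_null mN N0) -ge0_integralD//.
- apply: integral_le_nonmeasurable => x _; first exact: funepos_ge0.
  rewrite funeposE ge_max adde_ge0 ?andbT//.
  rewrite patchE; case: ifPn => [_|xN].
    by rewrite addey ?leey// gt_eqF// (lt_le_trans _ (g0 x)).
  rewrite adde0; apply: contrapT => fgx.
  by move: xN; rewrite notin_setE; apply; exact: fgN.
- by apply/(measurable_restrictT _ _).1 => //; exact: measurable_cst.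
Qed.

(** The negative part of [f] lives on the exceptional null set, so its integral is 0; removing that
    set does not change the integral of the measurable [g]. *)
Lemma ae_integral_ge f g : measurable_fun [set: T] g -> (forall x, 0 <= g x) ->
  {ae mu, forall x, g x <= f x} -> \int[mu]_x g x <= \int[mu]_x f x.
Proof.
move=> mg g0 [N [mN N0 fgN]].
have gf x : x \notin N -> g x <= f x.
  move=> xN; apply: contrapT => fgx.
  by move: xN; rewrite notin_setE; apply; exact: fgN.
rewrite [leRHS]integralE [X in _ - X](_ : _ = 0); last first.
  apply/eqP; rewrite eq_le integral_ge0// andbT.
  rewrite -(integral_infty_null mN N0).
  apply: integral_le_nonmeasurable => x _; first exact: funeneg_ge0.
  rewrite patchE; case: ifPn => [_|xN]; first exact: leey.
  by rewrite funenegE ge_max lexx andbT oppe_le0 (le_trans (g0 x))// gf.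
rewrite sube0 (ge0_negligible_integral mN)// integral_mkcond.
apply: integral_le_nonmeasurable => x _; first exact: erestrict_ge0.
rewrite patchE; case: ifPn => [|_]; last exact: funepos_ge0.
rewrite inE => -[_ xN]; rewrite (@le_trans _ _ (f x))//.
  by apply: gf; rewrite notin_setE.
by rewrite funeposE le_max lexx.
Qed.

End nonmeasurable_integrands.

(** * Independence *)

Section independence.
Local Open Scope ereal_scope.
Context d (T : measurableType d) (R : realType) (P : probability T R).

(** Dynkin's argument: the events satisfying the product formula with [E] form a lambda-system
    containing the pi-system [G]. *)
Lemma indep_g_sigma_algebra (G : set (set T)) (E : set T) :
    setI_closed G -> G `<=` measurable -> measurable E ->
    (forall A, G A -> P (A `&` E) = P A * P E) ->
  forall A, <<s G >> A -> P (A `&` E) = P A * P E.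
Proof.
move=> GI Gm mE GE.
pose H := [set A | measurable A /\ P (A `&` E) = P A * P E].
suff GH : <<s G >> `<=` H by move=> A /GH[].
apply: lambda_system_subset => //; last by move=> A GA; split; [exact: Gm|exact: GE].
split => //.
- by split => //; rewrite setTI probability_setT mul1e.
- move=> A B BA [mA HA] [mB HB]; split; first exact: measurableD.
  have Poo C : measurable C -> P C < +oo.
    by move=> mC; rewrite ltey_eq fin_num_measure.
  have mAE : measurable (A `&` E) by exact: measurableI.
  have -> : P ((A `\` B) `&` E) = P (A `&` E) - P (A `&` E `&` B).
    rewrite (_ : (A `\` B) `&` E = (A `&` E) `\` B) ?measureD//; first exact: Poo.
    by apply/seteqP; split => x /=; tauto.
  rewrite setIAC (setIidr BA) HB HA measureD//; last exact: Poo.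
  by rewrite (setIidr BA) muleBl// ?fin_num_adde_defr// fin_num_measure.
- move=> F ndF HF; have mF n : measurable (F n) by have [] := HF n.
  split; first exact: bigcup_measurable.
  rewrite setI_bigcupl.
  have : P (F n `&` E) @[n --> \oo] --> P (\bigcup_n (F n `&` E)).
    apply: nondecreasing_cvg_mu.
    - by move=> n; exact: measurableI.
    - by apply: bigcup_measurable => n _; exact: measurableI.
    - by move=> m n mn; apply/subsetPset; apply: setSI; exact/subsetPset/ndF.
  under eq_fun => n do rewrite (HF n).2.
  move=> /cvg_lim <- //; apply/cvg_lim => //.
  apply: cvgeZr; first exact: fin_num_measure.
  by apply: nondecreasing_cvg_mu => //; exact: bigcup_measurable.
Qed.

(** The law of the pair agrees with the product of the two laws on rectangles, hence equals it;
    Tonelli then splits the integral. *)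
Lemma ge0_integral_indepM (X Y : T -> R) :
    measurable_fun [set: T] X -> measurable_fun [set: T] Y ->
    (forall w, 0 <= X w)%R -> (forall w, 0 <= Y w)%R ->
    (forall A B : set R, measurable A -> measurable B ->
       P (X @^-1` A `&` Y @^-1` B) = P (X @^-1` A) * P (Y @^-1` B)) ->
  \int[P]_w (X w * Y w)%:E = \int[P]_w (X w)%:E * \int[P]_w (Y w)%:E.
Proof.
move=> mX mY X0 Y0 XY.
pose X' : {mfun T >-> R} := HB.pack X (isMeasurableFun.Build _ _ _ _ _ mX).
pose Y' : {mfun T >-> R} := HB.pack Y (isMeasurableFun.Build _ _ _ _ _ mY).
have mXY : measurable_fun [set: T] (fun w => (X w, Y w)) by exact: measurable_fun_pair.
pose Z : {mfun T >-> (R * R)%type} := 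
  HB.pack (fun w => (X w, Y w)) (isMeasurableFun.Build _ _ _ _ _ mXY).
(* Tonelli is applied to a function nonnegative on the whole plane; [pos] provides this and is the
   identity on the values of [X] and [Y]. *)
pose pos (x : R) := (Num.max x 0)%:E.
have mpos : measurable_fun [set: R] pos.
  by apply/measurable_EFinP; apply: measurable_maxr => //; exact: measurable_id.
have pos0 x : 0 <= pos x by rewrite lee_fin le_max lexx orbT.
pose f (z : R * R) := pos z.1 * pos z.2.
have mf : measurable_fun [set: R * R] f.
  apply: emeasurable_funM.
  - exact: measurableT_comp mpos measurable_fst.
  - exact: measurableT_comp mpos measurable_snd.
have f0 z : 0 <= f z by exact: mule_ge0.
have -> : \int[P]_w (X w * Y w)%:E = \int[P]_w (f \o Z) w.
  by apply: eq_integral => w _; rewrite /f /pos /= !max_l.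
rewrite -ge0_integral_distribution//.
rewrite (eq_measure_integral (distribution P X' \x distribution P Y')%E); last first.
  move=> A mA _; apply/esym; apply: product_measure_unique => // B C mB mC.
rewrite fubini_tonelli1//= /f /fubini_F.
have cX : \int[P]_w (X w)%:E = \int[distribution P X']_x pos x.
  rewrite ge0_integral_distribution//.
  by apply: eq_integral => w _; rewrite /pos /= max_l.
have cY : \int[P]_w (Y w)%:E = \int[distribution P Y']_x pos x.
  rewrite ge0_integral_distribution//.
  by apply: eq_integral => w _; rewrite /pos /= max_l.
rewrite cX cY -ge0_integralZr//; last exact: integral_ge0.
by apply: eq_integral => x _; rewrite -ge0_integralZl.
Qed.

End independence.
(** * Renewal counting *)

Section half_sqr_trunc.
Context (R : realType).

(** Cutting at b keeps the mean finite when X^2 has infinite mean, and bounds by b^2 / 2 the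
    contribution of the interval straddling the horizon. *)
Definition half_sqr_trunc (b x : R) : R := (if `|x| <= b then x ^+ 2 / 2 else 0)%R.

Lemma half_sqr_trunc_ge0 b x : (0 <= half_sqr_trunc b x)%R.
Proof. by rewrite /half_sqr_trunc; case: ifPn => // _; rewrite divr_ge0// sqr_ge0. Qed.

Lemma half_sqr_trunc_le b x : (0 <= b)%R -> (half_sqr_trunc b x <= b ^+ 2 / 2)%R.
Proof.
move=> b0; rewrite /half_sqr_trunc; case: ifPn => xb; last by rewrite divr_ge0// sqr_ge0.
by rewrite ler_pM2r// -(real_normK (num_real x)) lerXn2r ?nnegrE.
Qed.

Lemma measurable_half_sqr : measurable_fun [set: R] (fun x : R => x ^+ 2 / 2)%R.
Proof. by apply: measurable_funM => //; exact: measurable_funX. Qed.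

Lemma measurable_half_sqr_trunc b : measurable_fun [set: R] (half_sqr_trunc b).
Proof.
apply: measurable_fun_ifT => //; last exact: measurable_half_sqr.
by apply: measurable_fun_ler => //; exact: normr_measurable.
Qed.

Lemma half_sqr_trunc_nd x : {homo half_sqr_trunc ^~ x : a b / (a <= b)%R}.
Proof.
move=> a b ab; rewrite /half_sqr_trunc; case: ifPn => xa; last first.
  by case: ifPn => // _; rewrite divr_ge0// sqr_ge0.
by rewrite ifT// (le_trans xa).
Qed.

End half_sqr_trunc.

Section renewal_process.
Local Open Scope ereal_scope.
Context d (T : measurableType d) (R : realType) (P : probability T R).
Variables (FX : probability R R) (X : nat -> {RV P >-> R}).
Hypothesis X_indep : mutually_independent X.
Hypothesis X_law : identically_distributed X FX.

(** A pi-system generating the sigma-algebra of X_0, ..., X_(n-1), the history before X_n. *)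
Definition cylinders (n : nat) : set (set T) :=
  [set \bigcap_(k in `I_n) (X k @^-1` B k)
     | B in [set B : nat -> set R | forall k, measurable (B k)]].

(* The epochs are built from absolute values so that they are nondecreasing
   everywhere and not only almost surely. *)
Definition epoch (n : nat) (w : T) : R := (\sum_(k < n) `|X k w|)%R.

Lemma epochS n w : epoch n.+1 w = (epoch n w + `|X n w|)%R.
Proof. by rewrite /epoch big_ord_recr. Qed.

Lemma epoch_ge0 n w : (0 <= epoch n w)%R.
Proof. exact: sumr_ge0. Qed.

Lemma epoch_nd w : {homo epoch ^~ w : m n / (m <= n)%N >-> (m <= n)%R}.
Proof.
move=> m n /subnK <-; elim: (n - m)%N => //= k IH.
by rewrite addSn epochS (le_trans IH)// lerDl.
Qed.

Lemma cylinders_setI n : setI_closed (cylinders n).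
Proof.
move=> _ _ [B mB <-] [C mC <-]; exists (fun k => B k `&` C k).
  by move=> k; exact: measurableI.
by rewrite -bigcapI.
Qed.

Lemma cylinders_measurable n : cylinders n `<=` measurable.
Proof.
move=> _ [B mB <-]; apply: bigcap_measurableType => k _.
by rewrite -[X in measurable X]setTI; exact: measurable_funP.
Qed.

(** Mutual independence is used twice: for the first n indices and, with [B] placed at index n, for
    the first n + 1. *)
Lemma cylinders_indep n A B : cylinders n A -> measurable B ->
  P (A `&` X n @^-1` B) = P A * P (X n @^-1` B).
Proof.
move=> [C mC <-] mB; pose C' k := if k == n then B else C k.
have mC' k : measurable (C' k) by rewrite /C'; case: ifPn.
have C'E k : (k < n)%N -> C' k = C k by move=> kn; rewrite /C' ltn_eqF.
have capE m (D : nat -> set R) : \bigcap_(k in `I_m) (X k @^-1` D k) =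
    \bigcap_(k in [set` iota 0 m]) (X k @^-1` D k).
  by congr bigcap; apply/seteqP; split => k /=; rewrite mem_iota.
have -> : \bigcap_(k in `I_n) (X k @^-1` C k) `&` X n @^-1` B =
    \bigcap_(k in `I_n.+1) (X k @^-1` C' k).
  apply/seteqP; split => [w [wC wB] k /=|w wC].
    rewrite ltnS leq_eqVlt => /predU1P[->|kn]; first by rewrite /C' eqxx.
    by rewrite C'E//; exact: wC.
  split; first by move=> k /= kn; rewrite -C'E//; apply: wC => /=; exact: ltnW.
  by have := wC n (ltnSn n); rewrite /C' eqxx.
rewrite !capE !X_indep ?iota_uniq// -addn1 iotaD big_cat big_seq1 add0n.
rewrite {2}/C' eqxx; congr (_ * _).
by apply: eq_big_seq => k; rewrite mem_iota => /C'E ->.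
Qed.

Definition history_measurable (n : nat) (V : T -> R) :=
  measurable_fun [set: g_sigma_algebraType (cylinders n)] V.

Lemma history_measurableW n V : history_measurable n V -> measurable_fun [set: T] V.
Proof.
move=> mV _ B mB; have := mV measurableT B mB.
rewrite !setTI; apply: smallest_sub; first exact: sigma_algebra_measurable.
exact: cylinders_measurable.
Qed.

Lemma history_measurable_X k n : (k < n)%N -> history_measurable n (X k).
Proof.
move=> kn _ B mB; rewrite setTI; apply: sub_sigma_algebra.
exists (fun j => if j == k then B else setT); first by move=> j; case: ifPn.
apply/seteqP; split => [w wB|w wB j _] /=.
  by have := wB k kn; rewrite eqxx.
by case: ifPn => // /eqP ->.
Qed.

Lemma history_measurable_epoch k n : (k <= n)%N -> history_measurable n (epoch k).
Proof.
move=> kn; rewrite /history_measurable /epoch.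
apply: measurable_sum => j; apply: measurableT_comp => //.
by apply: history_measurable_X; exact: leq_trans kn.
Qed.

Lemma history_measurable_indic_epoch k n s : (k <= n)%N ->
  history_measurable n (\1_[set w | (epoch k w <= s)%R]).
Proof.
move=> kn; apply: measurable_indic.
rewrite -[X in measurable X]setTI.
rewrite [X in _ `&` X](_ : _ = epoch k @^-1` `]-oo, s]).
  exact: (@history_measurable_epoch k).
by apply/seteqP; split => w /=; rewrite in_itv.
Qed.

(** Independence of [X n] from the cylinders extends to the whole history by the lambda-system
    argument. *)
Lemma integral_history (h : R -> R) n (W : T -> R) :
    measurable_fun [set: R] h -> (forall x, 0 <= h x)%R ->
    history_measurable n W -> (forall w, 0 <= W w)%R ->
  \int[P]_w (h (X n w) * W w)%:E = \int[FX]_x (h x)%:E * \int[P]_w (W w)%:E.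
Proof.
move=> mh h0 mW W0.
have mhX : measurable_fun [set: T] (h \o X n) by exact: measurableT_comp.
have mWT := history_measurableW mW.
have mpre B : measurable B -> measurable (h @^-1` B).
  by move=> mB; rewrite -[X in measurable X]setTI; exact: mh.
rewrite (ge0_integral_indepM mhX mWT) => [|w|//|A B mA mB]; last 2 first.
- exact: h0.
- rewrite comp_preimage setIC muleC.
  apply: (@indep_g_sigma_algebra _ _ _ P (cylinders n)).
  + exact: cylinders_setI.
  + exact: cylinders_measurable.
  + rewrite -[X in measurable X]setTI; apply: measurable_funP => //.
    exact: mpre.
  + by move=> C nC; apply: cylinders_indep => //; exact: mpre.
  + by rewrite -[X in <<s _ >> X]setTI; exact: mW.
congr (_ * _).
rewrite -(@ge0_integral_distribution _ _ _ _ _ P (X n) (EFin \o h))//; last first.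
  exact/measurable_EFinP.
by apply: eq_measure_integral => B mB _; exact: X_law.
Qed.

Let before (s : R) (n : nat) : set T := [set w | (epoch n w <= s)%R].

Let mbefore s n : measurable (before s n).
Proof.
rewrite -[X in measurable X]setTI.
rewrite [X in _ `&` X](_ : _ = epoch n @^-1` `]-oo, s]).
  by apply: (history_measurableW (@history_measurable_epoch n n (leqnn n))).
by apply/seteqP; split => w /=; rewrite in_itv.
Qed.

Let before1 (s : R) n w : (epoch n w <= s)%R -> \1_(before s n) w = 1%R :> R.
Proof. by move=> sw; rewrite indicE mem_set. Qed.

Let before0 (s : R) n w : (s < epoch n w)%R -> \1_(before s n) w = 0%R :> R.
Proof. by move=> sw; rewrite indicE memNset// /before /= leNgt sw. Qed.

(** Wald's argument: whether t_i <= s is decided by X_0, ..., X_(i-1), hence independently of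
    X_i. *)
Lemma integral_sum_before (h : R -> R) s n :
    measurable_fun [set: R] h -> (forall x, 0 <= h x)%R ->
  \int[P]_w (\sum_(i < n) h (X i w) * \1_(before s i) w)%R%:E =
  \int[FX]_x (h x)%:E * \sum_(i < n) P (before s i).
Proof.
move=> mh h0.
under eq_integral do rewrite -sumEFin.
rewrite ge0_integral_sum//=; last 2 first.
- move=> i; apply/measurable_EFinP; apply: measurable_funM.
    exact: measurableT_comp.
  apply: measurable_indic; exact: mbefore.
- by move=> i w _; rewrite lee_fin mulr_ge0.
rewrite ge0_sume_distrr//; apply: eq_bigr => i _.
rewrite integral_history//; last exact: (@history_measurable_indic_epoch i).
by rewrite integral_indic// setIT.
Qed.

(** Intervals opened up to time s are counted in full, so they cover [0, s] unless the first n
    intervals end earlier. *)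
Lemma min_epoch_le (s : R) n w : (0 <= s)%R ->
  (Num.min s (epoch n w) <= \sum_(i < n) `|X i w| * \1_(before s i) w)%R.
Proof.
move=> s0; elim: n => [|n IH]; first by rewrite !big_ord0 ge_min /epoch big_ord0 lexx orbT.
rewrite big_ord_recr/= epochS; have [ns|ns] := leP (epoch n w) s.
  rewrite before1// mulr1 ge_min; apply/orP; right; rewrite lerD2r.
  by apply: le_trans IH; rewrite min_r.
rewrite before0// mulr0 addr0; apply: le_trans IH.
by rewrite ge_min (min_l (ltW ns)) lexx.
Qed.

Lemma sum_min_before_le (s b : R) n w : (0 <= s)%R -> (0 <= b)%R ->
  (\sum_(i < n) Num.min `|X i w| b * \1_(before s i) w <= s + b)%R.
Proof.
move=> s0 b0.
(* The bound by [epoch n w] drives the induction: a term is added only when t_n <= s, so the sum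
   before it is at most s and the term at most b. *)
suff : (\sum_(i < n) Num.min `|X i w| b * \1_(before s i) w <=
        Num.min (epoch n w) (s + b))%R by rewrite le_min => /andP[].
elim: n => [|n IH]; first by rewrite !big_ord0 le_min addr_ge0// epoch_ge0.
rewrite big_ord_recr/= epochS; move: IH; rewrite !le_min => /andP[IH1 IH2].
have [ns|ns] := leP (epoch n w) s.
  rewrite before1// mulr1 lerD//=; last by rewrite ge_min lexx.
  by rewrite lerD// ?(le_trans IH1)// ge_min lexx orbT.
by rewrite before0// mulr0 addr0 IH2 andbT (le_trans IH1)// lerDl.
Qed.

Lemma sum_sqr_before_le (s b : R) n w : (0 <= b)%R ->
  (\sum_(i < n) half_sqr_trunc b (X i w) * \1_(before s i) w <=
   \sum_(i < n) (X i w) ^+ 2 / 2 * \1_(before s i.+1) w + b ^+ 2 / 2)%R.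
Proof.
move=> b0.
(* Apart from the truncation the two sums differ only by the interval straddling s, so the remainder
   is charged only once t_n has passed s. *)
suff : (\sum_(i < n) half_sqr_trunc b (X i w) * \1_(before s i) w <=
   \sum_(i < n) (X i w) ^+ 2 / 2 * \1_(before s i.+1) w +
     (if epoch n w <= s then 0 else b ^+ 2 / 2))%R.
  move=> /le_trans; apply; rewrite lerD2l; case: ifPn => // _.
  by rewrite divr_ge0// sqr_ge0.
elim: n => [|n IH].
  by rewrite !big_ord0 add0r; case: ifPn => // _; rewrite divr_ge0// sqr_ge0.
have sq0 : (0 <= X n w ^+ 2 / 2)%R by rewrite divr_ge0// sqr_ge0.
rewrite !big_ord_recr/=; move: IH.
have [ns|ns] := leP (epoch n w) s => IH; last first.
  have nS : (s < epoch n.+1 w)%R by rewrite epochS ltr_wpDr.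
  by rewrite !before0// !mulr0 !addr0 (leNgt (epoch n.+1 w)) nS.
rewrite before1// mulr1; rewrite addr0 in IH.
have [nS|nS] := leP (epoch n.+1 w) s.
  by rewrite before1// mulr1 addr0 lerD// /half_sqr_trunc; case: ifPn.
by rewrite before0// mulr0 addr0 lerD// half_sqr_trunc_le.
Qed.

Lemma integral_le_cst (f : T -> R) (c : R) : measurable_fun [set: T] f ->
  (forall w, 0 <= f w <= c)%R -> \int[P]_w (f w)%:E <= c%:E.
Proof.
move=> mf fc; rewrite -[leRHS]mule1 -[X in _ * X](probability_setT P).
rewrite -integral_cst//; apply: ge0_le_integral => //.
- by move=> w _; rewrite lee_fin; case/andP: (fc w).
- exact/measurable_EFinP.
- by move=> w _; rewrite lee_fin; case/andP: (fc w).
Qed.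

Let measurable_sum_before (h : R -> R) s n : measurable_fun [set: R] h ->
  measurable_fun [set: T] (fun w => \sum_(i < n) h (X i w) * \1_(before s i) w)%R.
Proof.
move=> mh; apply: measurable_sum => i; apply: measurable_funM.
  exact: measurableT_comp.
apply: measurable_indic; exact: mbefore.
Qed.

(** Expectation of [sum_min_before_le]; the cap b controls the overshoot of the last counted
    interval. *)
Lemma expected_epochs_le (s b : R) n : (0 <= s)%R -> (0 <= b)%R ->
  \int[FX]_x (Num.min `|x|%R b)%:E * \sum_(i < n) P (before s i) <= (s + b)%:E.
Proof.
move=> s0 b0.
have mh : measurable_fun [set: R] (fun x : R => Num.min `|x|%R b).
  by apply: measurable_minr => //; exact: normr_measurable.
have h0 x : (0 <= Num.min `|x| b)%R by rewrite le_min normr_ge0.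
rewrite -integral_sum_before//; apply: integral_le_cst.
  exact: (@measurable_sum_before _ s n mh).
move=> w; rewrite sum_min_before_le// andbT.
by apply: sumr_ge0 => i _; rewrite mulr_ge0.
Qed.

(** Expectation of [min_epoch_le], whose minimum is s on the event t_n > s. *)
Lemma expected_epochs_ge (s : R) n : (0 <= s)%R ->
  s%:E * (1 - P (before s n)) <=
  \int[FX]_x `|x|%:E * \sum_(i < n) P (before s i).
Proof.
move=> s0.
have mh : measurable_fun [set: R] (fun x : R => `|x|%R) by exact: normr_measurable.
rewrite -integral_sum_before//.
rewrite -probability_setC// -[X in P X]setTI -[X in P X]setIC.
rewrite -integral_indic//; last exact/measurableC/mbefore.
rewrite -ge0_integralZl//; last exact/measurable_EFinP/measurable_indic/measurableC/mbefore.
apply: ge0_le_integral => //.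
- by move=> w _; rewrite mule_ge0// lee_fin.
- apply: emeasurable_funM => //.
  exact/measurable_EFinP/measurable_indic/measurableC/mbefore.
- apply/measurable_EFinP; exact: (@measurable_sum_before _ s n mh).
move=> w _; rewrite -EFinM lee_fin; apply: le_trans (min_epoch_le n w s0).
have [ns|ns] := leP (epoch n w) s.
  rewrite indicE memNset ?mulr0; first exact: epoch_ge0.
  by apply; exact: ns.
by rewrite indicE; case: (_ \in _); rewrite ?mulr1// mulr0.
Qed.

(* If P(before s n) does not vanish its sum diverges, otherwise the previous
   bound tends to s. *)
Lemma expected_epochs_unbounded (s m c : R) : (0 < s)%R -> (0 < m)%R ->
    \int[FX]_x `|x|%:E = m%:E -> (c < s / m)%R ->
  exists n, c%:E <= \sum_(i < n) P (before s i).
Proof.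
move=> s0 m0 mE cs; apply: contrapT => nex.
have ltc n : \sum_(i < n) P (before s i) < c%:E.
  by rewrite ltNge; apply/negP => cn; apply: nex; exists n.
pose p n := fine (P (before s n)).
have pE n : P (before s n) = (p n)%:E by rewrite fineK// fin_num_measure//; exact: mbefore.
have sumE n : \sum_(i < n) P (before s i) = (\sum_(i < n) p i)%R%:E.
  by rewrite -sumEFin; apply: eq_bigr => i _; rewrite pE.
(* If all partial sums stay below c, the previous bound forces every [p n] to be at least this
   positive constant. *)
pose e := (1 - m * c / s)%R.
have e0 : (0 < e)%R.
  by rewrite subr_gt0 ltr_pdivrMr// mul1r mulrC -ltr_pdivlMr.
have pe n : (e <= p n)%R.
  have := @expected_epochs_ge s n (ltW s0).
  rewrite mE sumE pE -EFinB -!EFinM lee_fin => le1.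
  have := ltc n; rewrite sumE lte_fin => lt1.
  have : (s * (1 - p n) <= m * c)%R by rewrite (le_trans le1)// ler_pM2l// ltW.
  by rewrite mulrC -ler_pdivlMr// lerBlDr -lerBlDl.
have [n cn] : exists n : nat, (c < n%:R * e)%R.
  exists (Num.truncn (c / e)).+1.
  by rewrite -ltr_pdivrMr// truncnS_gt.
have := ltc n; rewrite sumE lte_fin ltNge => /negP; apply.
apply: (le_trans (ltW cn)).
rewrite (_ : n%:R * e = \sum_(i < n) e)%R; last by rewrite sumr_const card_ord mulr_natl.
by apply: ler_sum => i _; exact: pe.
Qed.

Lemma expected_sqr_ge (s b m : R) : (0 <= b)%R -> (0 < s)%R -> (0 < m)%R ->
    \int[FX]_x `|x|%:E = m%:E ->
  exists n, (s / m - 1)%R%:E * \int[FX]_x (half_sqr_trunc b x)%:E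
    <= \int[P]_w (\sum_(i < n) (X i w) ^+ 2 / 2 * \1_(before s i.+1) w)%R%:E
       + (b ^+ 2 / 2)%:E.
Proof.
move=> b0 s0 m0 mE.
(* Some constant strictly below s / m is required; the loss of 1 becomes a term of order 1 / s after
   division by the horizon. *)
have [|n ltn] := @expected_epochs_unbounded s m (s / m - 1) s0 m0 mE.
  by rewrite gtrBl.
exists n.
have mh := @measurable_half_sqr_trunc R b.
have h0 := @half_sqr_trunc_ge0 R b.
have sq0 x : (0 <= x ^+ 2 / 2 :> R)%R by rewrite divr_ge0// sqr_ge0.
apply: (@le_trans _ _ (\int[FX]_x (half_sqr_trunc b x)%:E *
  \sum_(i < n) P (before s i))).
  rewrite [leRHS]muleC; apply: lee_wpmul2r => //.
  by apply: integral_ge0 => x _; rewrite lee_fin; exact: h0.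
rewrite -integral_sum_before//.
have mS : measurable_fun [set: T]
    (fun w => \sum_(i < n) (X i w) ^+ 2 / 2 * \1_(before s i.+1) w)%R.
  apply: measurable_sum => i; apply: measurable_funM; last first.
    by apply: measurable_indic; exact: mbefore.
  exact: (measurableT_comp (@measurable_half_sqr R)).
rewrite -[X in _ <= _ + X]mule1 -[X in _ <= _ + _ * X](probability_setT P) -integral_cst//.
rewrite -ge0_integralD//=; last 3 first.
- by move=> w _; rewrite lee_fin sumr_ge0// => i _; rewrite mulr_ge0.
- exact/measurable_EFinP.
- by move=> w _; rewrite lee_fin.
apply: ge0_le_integral => //.
- by move=> w _; rewrite lee_fin sumr_ge0// => i _; rewrite mulr_ge0.
- exact/measurable_EFinP/measurable_sum_before.
- by apply: emeasurable_funD => //; exact/measurable_EFinP.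
by move=> w _; rewrite -EFinD lee_fin; exact: sum_sqr_before_le.
Qed.

(** * Late packets and the mean backlog *)

Variables (FS : probability R R) (S : nat -> {RV P >-> R}).
Hypothesis S_indep : mutually_independent S.
Hypothesis S_law : identically_distributed S FS.
Hypothesis XS_indep : independent_processes X S.

Definition all_late (e : R) (j i : nat) : set T :=
  \bigcap_(k in [set` iota j (i - j)]) (S k @^-1` `]e, +oo[%classic).

Let sigma_S := g_sigma_algebraType (\bigcup_i preimage_set_system setT (S i) measurable).

Lemma all_late_sigma e j i : sigma_generated S (all_late e j i).
Proof.
have mS k : sigma_generated S (S k @^-1` `]e, +oo[%classic).
  apply: sub_sigma_algebra; exists k => //; exists `]e, +oo[%classic => //.
  by rewrite setTI.
rewrite /all_late bigcap_seq; elim: (iota j (i - j)) => [|k l IH].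
  by rewrite big_nil; exact: (@measurableT _ sigma_S).
rewrite big_cons; exact: (@measurableI _ sigma_S _ _ (mS k) IH).
Qed.

Lemma measurable_all_late e j i : measurable (all_late e j i).
Proof.
apply: bigcap_measurableType => k _.
by rewrite -[X in measurable X]setTI; exact: measurable_funP.
Qed.

Lemma probability_all_late e j i :
  P (all_late e j i) = ((fine (FS `]e, +oo[%classic)) ^+ (i - j))%:E.
Proof.
rewrite /all_late S_indep ?iota_uniq//.
rewrite (eq_bigr (fun=> (fine (FS `]e, +oo[%classic))%:E)); last first.
  move=> k _; rewrite fineK ?fin_num_measure//; exact: S_law.
by rewrite prodEFin big_const_seq count_predT size_iota iter_mulr_1.
Qed.

(** The runs of late packets ending at i - 1 are nested, so this is t_i - t_j for the start j of the
    longest one. The form as a sum allows independence to be applied term by term. *)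
Definition backlog (e : R) (i : nat) (w : T) : R :=
  (\sum_(j < i) `|X j w| * \1_(all_late e j i) w)%R.

(** Three independences in turn: services from generations, X_i from its history (which contains X_j
    because j < i), and X_j from the event t_j <= s. *)
Lemma integral_late_cycle (s e m : R) j i : (j < i)%N ->
    \int[FX]_x `|x|%:E = m%:E ->
  \int[P]_w (`|X i w| * (`|X j w| * \1_(before s j) w) * \1_(all_late e j i) w)%R%:E =
  ((fine (FS `]e, +oo[%classic)) ^+ (i - j) * (m * (m * fine (P (before s j)))))%:E.
Proof.
move=> ji mE.
have mnormr : measurable_fun [set: R] (fun x : R => `|x|%R) by exact: normr_measurable.
pose G := g_sigma_algebraType (\bigcup_i preimage_set_system setT (X i) measurable).
have mX k : measurable_fun [set: G] (X k).
  move=> _ B mB; rewrite setTI; apply: sub_sigma_algebra; exists k => //.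
  by exists B => //; rewrite setTI.
have mEp k : measurable_fun [set: G] (epoch k).
  by apply: measurable_sum => l; exact: measurableT_comp.
have mU : measurable_fun [set: G]
    (fun w => `|X i w| * (`|X j w| * \1_(before s j) w))%R.
  apply: measurable_funM; first exact: measurableT_comp.
  apply: measurable_funM; first exact: measurableT_comp.
  apply: measurable_indic; rewrite -[X in measurable X]setTI.
  rewrite [X in _ `&` X](_ : _ = epoch j @^-1` `]-oo, s]); first exact: mEp.
  by apply/seteqP; split => w /=; rewrite in_itv.
have mV : history_measurable i (fun w => `|X j w| * \1_(before s j) w)%R.
  apply: measurable_funM.
    by apply: measurableT_comp => //; exact: history_measurable_X.
  by apply: history_measurable_indic_epoch; exact: ltnW.
rewrite (@ge0_integral_indepM _ _ _ P
  (fun w => `|X i w| * (`|X j w| * \1_(before s j) w))%R); last 5 first.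
- apply: measurable_funM; first exact: measurableT_comp.
  exact: (history_measurableW mV).
- by apply: measurable_indic; exact: measurable_all_late.
- by move=> w; rewrite !mulr_ge0.
- by [].
- move=> A B mA mB; apply: XS_indep.
    by rewrite -[X in sigma_generated _ X]setTI; exact: mU.
  have mI : measurable_fun [set: sigma_S] 
      (\1_(all_late e j i) : T -> R).
    by apply: measurable_indic; exact: all_late_sigma.
  by rewrite -[X in sigma_generated _ X]setTI; exact: mI.
rewrite (@integral_history (fun x => `|x|%R) i
  (fun w => `|X j w| * \1_(before s j) w)%R)//; last first.
rewrite (@integral_history (fun x => `|x|%R) j (\1_(before s j)))//; last first.
  exact: history_measurable_indic_epoch.
rewrite !integral_indic//; last exact: measurable_all_late.
transitivity (m%:E * (m%:E * (fine (P (before s j)))%:E) *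
    ((fine (FS `]e, +oo[%classic)) ^+ (i - j))%:E); last first.
  by rewrite -!EFinM; congr EFin; ring.
rewrite (setIT (before s j)) (setIT (all_late e j i)) -mE -probability_all_late.
by rewrite fineK// fin_num_measure//; exact: mbefore.
Qed.

Lemma sum_geometric_le (q : R) (p : nat -> R) n : (0 <= q < 1)%R ->
    (forall i, 0 <= p i)%R ->
  (\sum_(i < n) \sum_(j < i) q ^+ (i - j) * p j <= q / (1 - q) * \sum_(i < n) p i)%R.
Proof.
move=> /andP[q0 q1] p0; pose C i := (\sum_(j < i) q ^+ (i - j) * p j)%R.
have C0 i : (0 <= C i)%R by apply: sumr_ge0 => j _; rewrite mulr_ge0// exprn_ge0.
have CS i : C i.+1 = (q * (C i + p i))%R.
  rewrite /C big_ord_recr/= subSnn expr1 mulrDr; congr (_ + _)%R.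
  by rewrite mulr_sumr; apply: eq_bigr => j _; rewrite subSn ?exprS ?mulrA// ltnW.
have q1' : (0 < 1 - q)%R by rewrite subr_gt0.
(* Summing the recursion for [C] gives an exact identity, from which the nonnegative [C n] is
   dropped. *)
suff H : ((1 - q) * \sum_(i < n) C i = q * \sum_(i < n) p i - C n)%R.
  rewrite mulrAC ler_pdivlMr// mulrC H gerBl//.
elim: n => [|n IH]; first by rewrite !big_ord0 /C big_ord0 !mulr0 subr0.
by rewrite !big_ord_recr/= CS mulrDr IH; ring.
Qed.

Lemma expected_cycles_le (s e b m m2 mb : R) n :
    (0 <= s)%R -> (0 <= e)%R -> (0 <= b)%R -> (0 <= m)%R -> (0 < mb)%R ->
    \int[FX]_x `|x|%:E = m%:E -> \int[FX]_x (x ^+ 2)%:E = m2%:E ->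
    \int[FX]_x (Num.min `|x|%R b)%:E = mb%:E ->
    (fine (FS `]e, +oo[%classic) < 1)%R ->
  \int[P]_w (\sum_(i < n) (\1_(before s i) w *
      (e * `|X i w| + (X i w) ^+ 2 / 2 + `|X i w| * backlog e i w)))%R%:E <=
  ((e * m + m2 / 2 + fine (FS `]e, +oo[%classic) / (1 - fine (FS `]e, +oo[%classic)) * m ^+ 2)
     * ((s + b) / mb))%:E.
Proof.
move=> s0 e0 b0 m0 mb0 mE m2E mbE q1.
set q := fine (FS `]e, +oo[%classic) in q1 *.
have q0 : (0 <= q)%R by apply: fine_ge0.
pose p i := fine (P (before s i)).
have p0 i : (0 <= p i)%R by apply: fine_ge0.
have pE i : P (before s i) = (p i)%:E.
  by rewrite fineK// fin_num_measure//; exact: mbefore.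
have m20 : (0 <= m2)%R.
  by rewrite -lee_fin -m2E; apply: integral_ge0 => x _; rewrite lee_fin sqr_ge0.
pose h x := (e * `|x| + x ^+ 2 / 2 : R)%R.
have mnormr : measurable_fun [set: R] (fun x : R => `|x|%R) by exact: normr_measurable.
have msqr : measurable_fun [set: R] (fun x : R => (x ^+ 2)%R) by exact: measurable_funX.
have mh : measurable_fun [set: R] h.
  by apply: measurable_funD; apply: measurable_funM.
have h0 x : (0 <= h x)%R.
  by apply: addr_ge0; [exact: mulr_ge0|apply: divr_ge0 => //; exact: sqr_ge0].
have hE : \int[FX]_x (h x)%:E = (e * m + m2 / 2)%:E.
  under eq_integral do rewrite /h EFinD EFinM (mulrC _ 2^-1)%R EFinM.
  rewrite ge0_integralD//=; last 4 first.
  - by move=> x _; rewrite -EFinM lee_fin mulr_ge0.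
  - by apply/measurable_EFinP; apply: measurable_funM.
  - by move=> x _; rewrite -EFinM lee_fin mulr_ge0 ?invr_ge0 ?sqr_ge0.
  - by apply/measurable_EFinP; apply: measurable_funM.
  rewrite !ge0_integralZl//=; last 3 first.
  - exact/measurable_EFinP.
  - by move=> x _; rewrite lee_fin sqr_ge0.
  - exact/measurable_EFinP.
  by rewrite mE m2E -!EFinM -EFinD [(_ * m2)%R]mulrC.
(* The event t_i <= s is enlarged to t_j <= s: unlike the former, the latter is independent of
   X_j. *)
pose late i j w := (`|X i w| * (`|X j w| * \1_(before s j) w) * \1_(all_late e j i) w)%R.
have late0 i j w : (0 <= late i j w)%R by rewrite !mulr_ge0.
have mX i : measurable_fun [set: T] (X i) by exact: measurable_funP.
have mnX i : measurable_fun [set: T] (fun w => `|X i w|%R) by exact: measurableT_comp.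
have mI i : measurable_fun [set: T] (\1_(before s i) : T -> R).
  by apply: measurable_indic; exact: mbefore.
have mL i j : measurable_fun [set: T] (\1_(all_late e i j) : T -> R).
  by apply: measurable_indic; exact: measurable_all_late.
have mlate i j : measurable_fun [set: T] (late i j).
  by do 2 apply: measurable_funM => //; apply: measurable_funM.
apply: (@le_trans _ _ (\int[P]_w ((\sum_(i < n) h (X i w) * \1_(before s i) w)%R%:E
    + (\sum_(i < n) \sum_(j < i) late i j w)%R%:E))).
  apply: ge0_le_integral => //.
  - move=> w _; rewrite lee_fin; apply: sumr_ge0 => i _.
    rewrite mulr_ge0//; apply: addr_ge0; first exact: h0.
    by rewrite mulr_ge0//; apply: sumr_ge0 => j _; rewrite mulr_ge0.
  - apply/measurable_EFinP; apply: measurable_sum => i.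
    apply: measurable_funM => //; apply: measurable_funD.
      exact: (measurableT_comp mh (mX i)).
    apply: measurable_funM => //; apply: measurable_sum => j.
    exact: measurable_funM.
  - apply: emeasurable_funD; apply/measurable_EFinP; apply: measurable_sum => i.
      by apply: measurable_funM => //; exact: measurableT_comp.
    by apply: measurable_sum => j.
  move=> w _; rewrite -EFinD lee_fin -big_split/=; apply: ler_sum => i _.
  rewrite mulrDr lerD//; first by rewrite mulrC.
  rewrite /backlog !mulr_sumr; apply: ler_sum => j _.
  have [iw|iw] := leP (epoch i w) s; last first.
    by rewrite before0// mul0r.
  rewrite (before1 iw) mul1r /late before1 ?mulr1 ?mulrA//.
  by apply: le_trans iw; apply: epoch_nd; exact: ltnW.
rewrite ge0_integralD//=; last 4 first.
- by move=> w _; rewrite lee_fin sumr_ge0// => i _; rewrite mulr_ge0.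
- by apply/measurable_EFinP; apply: measurable_sum_before.
- by move=> w _; rewrite lee_fin; do 2 apply: sumr_ge0 => ? _.
- apply/measurable_EFinP; apply: measurable_sum => i.
  by apply: measurable_sum => j.
rewrite integral_sum_before// hE.
have -> : \int[P]_w (\sum_(i < n) \sum_(j < i) late i j w)%R%:E =
    (\sum_(i < n) \sum_(j < i) q ^+ (i - j) * (m * (m * p j)))%R%:E.
  under eq_integral do rewrite -sumEFin.
  rewrite ge0_integral_sum//=; last 2 first.
  - by move=> i; apply/measurable_EFinP; apply: measurable_sum => j.
  - by move=> i w _; rewrite lee_fin; apply: sumr_ge0.
  rewrite -sumEFin; apply: eq_bigr => i _.
  under eq_integral do rewrite -sumEFin.
  rewrite ge0_integral_sum//=; last 2 first.
  - by move=> j; apply/measurable_EFinP.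
  - by move=> j w _; rewrite lee_fin.
  by rewrite -sumEFin; apply: eq_bigr => j _; exact: integral_late_cycle.
have sumE : \sum_(i < n) P (before s i) = (\sum_(i < n) p i)%R%:E.
  by rewrite -sumEFin; apply: eq_bigr => i _; rewrite pE.
have := expected_epochs_le n s0 b0; rewrite mbE sumE -!EFinM !lee_fin => pb.
have pb' : (\sum_(i < n) p i <= (s + b) / mb)%R by rewrite ler_pdivlMr// mulrC.
apply: (@le_trans _ _
  ((e * m + m2 / 2 + q / (1 - q) * m ^+ 2) * \sum_(i < n) p i)%R); last first.
  rewrite ler_wpM2l// addr_ge0//; first by rewrite addr_ge0 ?divr_ge0 ?mulr_ge0.
  by rewrite mulr_ge0 ?sqr_ge0// divr_ge0// subr_ge0 ltW.
rewrite [leRHS]mulrDl lerD2l.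
have -> : (\sum_(i < n) \sum_(j < i) q ^+ (i - j) * (m * (m * p j)) =
   m ^+ 2 * \sum_(i < n) \sum_(j < i) q ^+ (i - j) * p j)%R.
  rewrite mulr_sumr; apply: eq_bigr => i _; rewrite mulr_sumr.
  by apply: eq_bigr => j _; ring.
rewrite -[leRHS]mulrA [leRHS]mulrCA; apply: ler_wpM2l; first exact: sqr_ge0.
by apply: sum_geometric_le => //; rewrite q0 q1.
Qed.
(** If all epochs stayed below s with probability c > 0, the mean number of epochs among the first n
    would be at least n c, against the uniform bound of [expected_epochs_le]. *)
Lemma ae_epoch_unbounded (s b mb : R) :
    (0 <= s)%R -> (0 <= b)%R -> (0 < mb)%R ->
    \int[FX]_x (Num.min `|x|%R b)%:E = mb%:E ->
  {ae P, forall w, exists n, (s < epoch n w)%R}.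
Proof.
move=> s0 b0 mb0 mbE; pose N := \bigcap_n before s n.
have mN : measurable N by apply: bigcapT_measurable => n; exact: mbefore.
exists N; split => //; last first.
  move=> w /= nex n _; rewrite /before /= leNgt; apply/negP => sn.
  by apply: nex; exists n.
have finN : P N \is a fin_num by exact: fin_num_measure.
rewrite -[P N]fineK//; congr EFin; apply/eqP; rewrite eq_le fine_ge0// andbT.
rewrite leNgt; apply/negP => c0; set c := fine (P N) in c0.
have le n : (mb * (n%:R * c) <= s + b)%R.
  have := expected_epochs_le n s0 b0; rewrite mbE -lee_fin; apply: le_trans.
  rewrite EFinM; apply: lee_wpmul2l; first by rewrite lee_fin ltW.
  rewrite (_ : n%:R * c = \sum_(i < n) c)%R; last first.
    by rewrite sumr_const card_ord mulr_natl.
  rewrite -sumEFin; apply: lee_sum => i _; rewrite /c fineK//.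
  by apply: le_measure; rewrite ?inE//; exact: bigcap_inf.
have := le (Num.truncn ((s + b) / (mb * c))).+1.
apply/negP; rewrite -ltNge mulrCA -ltr_pdivrMr ?mulr_gt0//.
exact: truncnS_gt.
Qed.

End renewal_process.

(** * Integral of the age along a sample path *)

Section affine_integral.
Context (R : realType).
Notation mu := (@lebesgue_measure R).

Lemma integral_affine (a b c : R) : a <= b ->
  (\int[mu]_(x in `[a, b[) (x - c)%:E = (((b - c) ^+ 2 - (a - c) ^+ 2) / 2)%:E)%E.
Proof.
rewrite le_eqVlt => /predU1P[->|ab].
  by rewrite subrr mul0r set_itvco0// integral_set0.
rewrite integral_itv_bndo_bndc; last first.
  by apply/measurable_EFinP; apply: measurable_funB.
have cf : continuous (fun x : R => x - c).
  by move=> x; apply: cvgB; [exact: cvg_id|exact: cvg_cst].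
pose F (x : R) : R := (x - c) ^+ 2 / 2.
have dF (x : R) : is_derive x (1 : R) F (x - c).
  have dB : is_derive x (1 : R) (fun y : R => y - c) 1.
    by apply: is_derive_eq; rewrite subr0.
  rewrite /F; apply: is_derive_eq.
  by rewrite !scaler0 add0r /GRing.scale/= mulr1; field.
have cF (x : R) : F y @[y --> x] --> F x.
  by apply: differentiable_continuous; apply/derivable1_diffP; have [] := dF x.
rewrite (@continuous_FTC2 _ (fun x => x - c) F)//.
- by rewrite -EFinB mulrBl.
- exact/continuous_subspaceT.
- split.
  + by move=> x _; have [] := dF x.
  + exact/cvg_at_right_filter/cF.
  + exact/cvg_at_left_filter/cF.
- by move=> x _; rewrite derive1E; have [_ ->] := dF x.
Qed.

Lemma integral_affine_indic (a b c : R) : a <= b ->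
  (\int[mu]_x (\1_(`[a, b[%classic) x * (x - c))%:E =
   (((b - c) ^+ 2 - (a - c) ^+ 2) / 2)%:E)%E.
Proof.
move=> ab; rewrite -integral_affine// [RHS]integral_mkcond.
apply: eq_integral => x _; rewrite patchE indicE.
by case: (_ \in _); rewrite ?mul1r ?mul0r.
Qed.

End affine_integral.
Section sample_paths.
Context (R : realType) (FX FS : probability R R) (Q : GGinf_queue FX FS).
Notation X := (interarrival Q).
Notation S := (service Q).
Notation mu := (@lebesgue_measure R).
Variable w : qspace Q.
Hypothesis X_gt0 : forall i, 0 < X i w.
Hypothesis S_ge0 : forall i, 0 <= S i w.

(** Index shift: interval 0 precedes the first packet, so packet i is generated at epoch i + 1, the
    end of interval i. *)
Let generation_timeE i : generation_time (Q := Q) i w = epoch X i.+1 w.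
Proof. by apply: eq_bigr => k _; rewrite ger0_norm// ltW. Qed.

Let received_le t i : received (Q := Q) t w i -> epoch X i.+1 w <= t.
Proof. by rewrite -generation_timeE; apply: le_trans; rewrite lerDl. Qed.

Lemma age_ge0 t : 0 <= t -> (0 <= age (Q := Q) t w)%E.
Proof.
move=> t0; rewrite /age; case: ifPn => _; first by rewrite lee_fin.
apply: le_ereal_inf_tmp => _ [i ri <-].
by rewrite lee_fin subr_ge0 generation_timeE received_le.
Qed.

Lemma age_le_received t i : received (Q := Q) t w i ->
  (age (Q := Q) t w <= (t - epoch X i.+1 w)%:E)%E.
Proof.
move=> ri; rewrite /age ifF; last first.
  by apply/negbTE/set0P; exists i.
by apply: ereal_inf_lbound; exists i => //; rewrite generation_timeE.
Qed.

Lemma age_le t : 0 <= t -> (age (Q := Q) t w <= t%:E)%E.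
Proof.
move=> t0; have [r0|/set0P[i ri]] := eqVneq (received (Q := Q) t w) set0.
  by rewrite /age r0 eqxx.
by rewrite (le_trans (age_le_received ri))// lee_fin gerBl epoch_ge0.
Qed.

Lemma age_ge t i : 0 <= t -> epoch X i w <= t < epoch X i.+1 w ->
  ((t - epoch X i w)%:E <= age (Q := Q) t w)%E.
Proof.
move=> t0 /andP[it ti]; rewrite /age; case: ifPn => _.
  by rewrite lee_fin gerBl epoch_ge0.
apply: le_ereal_inf_tmp => _ [j rj <-].
rewrite lee_fin lerD2l lerN2 generation_timeE; apply: epoch_nd.
rewrite ltnNge; apply/negP => ij.
have := le_trans (epoch_nd X w (ij : (i.+1 <= j.+1)%N)) (received_le rj).
by rewrite leNgt ti.
Qed.

(* [j] is the interval opened by the last packet before [i] that was not late,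
   or the initial one. *)
Lemma last_not_late (e : R) i : exists2 j, (j <= i)%N &
  (j = 0%N \/ exists2 k, j = k.+1 & S k w <= e) /\
  (forall k, (j <= k < i)%N -> e < S k w).
Proof.
elim: i => [|i [j ji [j0 late]]].
  by exists 0%N => //; split; [left|case].
have [Se|eS] := leP (S i w) e.
  exists i.+1 => //; split; first by right; exists i.
  by move=> k /andP[ik ki]; move: (leq_ltn_trans ik ki); rewrite ltnn.
exists j; first exact: leqW.
split => // k /andP[jk]; rewrite ltnS leq_eqVlt => /predU1P[->//|ki].
by apply: late; rewrite jk.
Qed.

(** The last packet before interval i that was not late has arrived by t_i + e; the epoch t_j at
    which it was generated satisfies t_i - t_j <= B_i, since all later packets before i are late. *)
Lemma age_le_backlog (e t : R) i : 0 <= e -> epoch X i w + e <= t ->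
  (age (Q := Q) t w <= (t - (epoch X i w - backlog X S e i w))%:E)%E.
Proof.
move=> e0 iet; have [j ji [j0 late]] := last_not_late e i.
have it : epoch X i w <= t by rewrite (le_trans _ iet)// lerDl.
have t0 : 0 <= t by rewrite (le_trans _ it)// epoch_ge0.
apply: (@le_trans _ _ (t - epoch X j w)%:E).
  (* For j = 0 there is no such packet, and the convention of being up to date at time 0 bounds the
     age by t. *)
  case: j0 => [->|[k jk Sk]]; first by rewrite /epoch big_ord0 subr0 age_le.
  rewrite jk; apply: age_le_received.
  rewrite /received /= /reception_time generation_timeE (le_trans _ iet)//.
  by rewrite lerD// epoch_nd// -jk.
rewrite lee_fin lerD2l lerN2 lerBlDr -lerBlDl.
rewrite /epoch /backlog -!(big_mkord xpredT (fun k => `|X k w|)).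
rewrite (big_cat_nat (leq0n j) ji)//= addrAC subrr add0r.
rewrite -(big_mkord xpredT (fun k => `|X k w| * \1_(all_late S e k i) w)).
rewrite [leRHS](big_cat_nat (leq0n j) ji)//= -[leLHS]add0r lerD//.
  by apply: sumr_ge0 => k _; rewrite mulr_ge0.
rewrite [leLHS]big_seq_cond [leRHS]big_seq_cond; apply: ler_sum => k.
rewrite andbT mem_index_iota => /andP[jk ki].
rewrite indicE mem_set ?mulr1// => l /=; rewrite mem_iota subnKC ?(ltnW ki)//.
by move=> /andP[kl li]; rewrite in_itv/= andbT late// (leq_trans jk).
Qed.

Lemma integral_age_ge (s : R) n : 0 <= s ->
  ((\sum_(i < n) X i w ^+ 2 / 2 * \1_[set w | epoch X i.+1 w <= s] w)%:E <=
   \int[mu]_(t in `[0%R, s]) age (Q := Q) t w)%E.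
Proof.
move=> s0; pose b i : R := \1_[set w | epoch X i.+1 w <= s] w.
pose I i : set R := `[epoch X i w, epoch X i.+1 w[%classic.
pose g i (t : R) := b i * (\1_(I i) t * (t - epoch X i w)).
have g0 i t : 0 <= g i t.
  rewrite /g indicE; case: (boolP (t \in I i)) => tI; last by rewrite mul0r mulr0.
  rewrite mul1r mulr_ge0// subr_ge0.
  by move: tI; rewrite inE /I/= in_itv/= => /andP[].
have mg i : measurable_fun [set: R] (g i).
  apply: measurable_funM => //; apply: measurable_funM.
    by apply: measurable_indic; exact: measurable_itv.
  exact: measurable_funB.
have mgE i : measurable_fun [set: R] (fun t => (g i t)%:E) by exact/measurable_EFinP.
apply: (@le_trans _ _ (\int[mu]_(t in `[0%R, s]) (\sum_(i < n) g i t)%:E)%E); last first.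
  apply: integral_le_nonmeasurable => t; rewrite /= in_itv/= => /andP[t0 ts].
    by rewrite lee_fin sumr_ge0.
  (* The intervals are disjoint, so at most one summand is nonzero at t. *)
  have [[i it]|nI] := pselect (exists i : 'I_n, I i t); last first.
    rewrite big1 ?age_ge0// => i _; rewrite /g indicE memNset ?mul0r ?mulr0//.
    by move=> it; apply: nI; exists i.
  rewrite (bigD1 i)//= big1 ?addr0 => [|j ji].
    have := it; rewrite /I/= in_itv/= => itv.
    apply: le_trans (age_ge t0 itv); rewrite lee_fin /g indicE mem_set// mul1r.
    rewrite ler_piMl//; first by rewrite subr_ge0; case/andP: itv.
    by rewrite /b indicE; case: (_ \in _).
  rewrite /g indicE memNset ?mul0r ?mulr0// /I/= in_itv/= => /andP[jt tj].
  move: it; rewrite /I/= in_itv/= => /andP[it ti].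
  have := ji; rewrite -val_eqE/= neq_ltn => /orP[lt|lt].
    by have := lt_le_trans tj (epoch_nd X w lt); rewrite ltNge it.
  by have := lt_le_trans ti (epoch_nd X w lt); rewrite ltNge jt.
under eq_integral do rewrite -sumEFin.
rewrite ge0_integral_sum//=; last 2 first.
- by move=> i; apply: measurable_funTS; exact: mgE.
- by move=> i t _; rewrite lee_fin.
rewrite -sumEFin; apply: lee_sum => i _.
rewrite /g -/(b i); have [iS|iS] := leP (epoch X i.+1 w) s; last first.
  rewrite /b indicE memNset ?mulr0; first by apply: integral_ge0 => t _; rewrite mul0r.
  by rewrite /= leNgt iS.
rewrite /b indicE mem_set// mulr1; under eq_integral do rewrite mul1r.
rewrite integral_mkcond.
rewrite [leRHS](_ : _ = \int[mu]_t (\1_(I i) t * (t - epoch X i w))%:E)%E; last first.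
  apply: eq_integral => t _; rewrite patchE; case: ifPn => // tN.
  rewrite indicE memNset ?mul0r// /I/= in_itv/= => /andP[it ti].
  move: tN; rewrite notin_setE/= in_itv/=; apply.
  by rewrite (le_trans (epoch_ge0 X i w) it)/= (le_trans (ltW ti)).
rewrite integral_affine_indic; last exact: epoch_nd.
by rewrite subrr expr0n subr0 epochS addrC addKr ger0_norm// ltW.
Qed.

Lemma integral_age_le (s e : R) : 0 <= s -> 0 <= e ->
    (exists n, s < epoch X n w) ->
  (\int[mu]_(t in `[0%R, s]) age (Q := Q) t w <=
   (e ^+ 2 / 2)%:E + \sum_(i <oo) (\1_[set w | epoch X i w <= s] w *
      (e * `|X i w| + (X i w) ^+ 2 / 2 + `|X i w| * backlog X S e i w))%:E)%E.
Proof.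
move=> s0 e0 exn; pose b i : R := \1_[set w | epoch X i w <= s] w.
pose B i := backlog X S e i w.
have B0 i : 0 <= B i by apply: sumr_ge0 => j _; rewrite mulr_ge0.
pose I i : set R := `[epoch X i w + e, epoch X i.+1 w + e[%classic.
pose h i (t : R) := \1_(I i) t * (t - (epoch X i w - B i)) : R.
pose g i (t : R) := b i * h i t.
have h0 i t : 0 <= h i t.
  rewrite /h indicE; case: (boolP (t \in I i)) => tI; last by rewrite mul0r.
  rewrite mul1r subr_ge0 lerBlDr.
  move: tI; rewrite inE /I/= in_itv/= => /andP[it _].
  by rewrite ler_wpDr// (le_trans _ it)// lerDl.
have g0 i t : 0 <= g i t by rewrite mulr_ge0.
have mh i : measurable_fun [set: R] (h i).
  apply: measurable_funM; first by apply: measurable_indic; exact: measurable_itv.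
  exact: measurable_funB.
have mg i : measurable_fun [set: R] (g i) by exact: measurable_funM.
have mhE i : measurable_fun [set: R] (fun t => (h i t)%:E) by exact/measurable_EFinP.
have mgE i : measurable_fun [set: R] (fun t => (g i t)%:E) by exact/measurable_EFinP.
(* The shifted intervals start at e; on [0, e[ the age is at most t, which yields the term e^2 /
   2. *)
pose g00 (t : R) := \1_(`[0%R, e[%classic) t * (t - 0) : R.
have g000 t : 0 <= g00 t.
  rewrite /g00 subr0 indicE; case: (boolP (t \in _)) => tI; last by rewrite mul0r.
  by rewrite mul1r; move: tI; rewrite inE/= in_itv/= => /andP[].
have mg00 : measurable_fun [set: R] g00.
  apply: measurable_funM; first by apply: measurable_indic; exact: measurable_itv.
  exact: measurable_funB.
pose G (t : R) := ((g00 t)%:E + \sum_(i <oo) (g i t)%:E)%E.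
have G0 t : (0 <= G t)%E.
  by rewrite adde_ge0 ?lee_fin//; apply: nneseries_ge0 => i _ _; rewrite lee_fin.
have mser : measurable_fun [set: R] (fun t => \sum_(i <oo) (g i t)%:E)%E.
  apply: ge0_emeasurable_sum => [i t _ _|i _]; first by rewrite lee_fin.
  exact/measurable_EFinP.
have mG : measurable_fun [set: R] G.
  by apply: emeasurable_funD => //; exact/measurable_EFinP.
apply: (@le_trans _ _ (\int[mu]_(t in `[0%R, s]) G t)%E).
  apply: integral_le_nonmeasurable => t; rewrite /= in_itv/= => /andP[t0 ts].
    exact: age_ge0.
  have [te|et] := ltP t e.
    rewrite (le_trans (age_le t0))// /G /g00 indicE mem_set; last first.
      by rewrite /= in_itv/= t0.
    rewrite mul1r subr0 leeDl//.
    by apply: nneseries_ge0 => i _ _; rewrite lee_fin.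
  (* The first epoch beyond t - e ends the interval whose shift by e contains t; it is not epoch 0,
     which equals 0. *)
  have [n nt nmin] : exists2 n, t - e < epoch X n w &
      forall m, t - e < epoch X m w -> (n <= m)%N.
    have exb : exists n, t - e < epoch X n w.
      by case: exn => n sn; exists n; rewrite (le_lt_trans _ sn)// lerBlDr ler_wpDr.
    by case: (ex_minnP exb) => n; exists n.
  case: n nt nmin => [|i] nt nmin.
    by move: nt; rewrite /epoch big_ord0 ltNge subr_ge0 et.
  have it : epoch X i w <= t - e.
    by rewrite leNgt; apply/negP => /nmin; rewrite ltnn.
  apply: (@le_trans _ _ (g i t)%:E).
    rewrite /g /h indicE mem_set; last first.
      by rewrite /I/= in_itv/= -lerBrDr it -ltrBlDr nt.
    rewrite mul1r /b indicE mem_set ?mul1r; last first.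
      by rewrite /= (le_trans it)// lerBlDr ler_wpDr.
    by apply: age_le_backlog => //; rewrite -lerBrDr.
  rewrite /G; apply: (@le_trans _ _ (\sum_(i <oo) (g i t)%:E)%E); last first.
    by rewrite leeDr// lee_fin.
  apply: le_trans (nneseries_lim_ge i.+1 _); last by move=> *; rewrite lee_fin.
  rewrite big_nat_recr//= leeDr//.
  by apply: sume_ge0 => j _; rewrite lee_fin.
apply: (@le_trans _ _ (\int[mu]_t G t)%E).
  by apply: ge0_subset_integral.
rewrite ge0_integralD//=; last 3 first.
- by move=> t _; rewrite lee_fin.
- exact/measurable_EFinP.
- by move=> t _; apply: nneseries_ge0 => i _ _; rewrite lee_fin.
apply: leeD.
  by rewrite integral_affine_indic// !subr0 expr0n subr0.
rewrite integral_nneseries//=; last by move=> i t _; rewrite lee_fin.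
apply: lee_nneseries => [i _ _|i _].
  by apply: integral_ge0 => t _; rewrite lee_fin.
under eq_integral do rewrite EFinM.
rewrite ge0_integralZl_EFin//; [|by move=> t _; rewrite lee_fin|exact: mhE].
(* The trapezoid has area ((X_i + e + B_i)^2 - (e + B_i)^2) / 2. *)
rewrite integral_affine_indic; last by rewrite lerD2r epoch_nd.
rewrite -EFinM lee_fin -/(b i) -/(B i) epochS le_eqVlt; apply/orP; left; apply/eqP.
by rewrite -(real_normK (num_real (X i w))); field.
Qed.

End sample_paths.
(** * Bounds on the average age *)

Section limf_esup_bounds.
Local Open Scope ereal_scope.
Context (R : realType).

Lemma limf_esup_ge (f : R -> \bar R) (c k : R) :
  (forall s, (0 < s)%R -> (c - k / s)%:E <= f s) -> c%:E <= limf_esup f +oo%R.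
Proof.
move=> fge; apply: le_ereal_inf_tmp => _ [V FV <-].
apply/lee_addgt0Pr => e e0.
have [s [Vs s0 ks]] : exists s, [/\ V s, (0 < s)%R & (k / s <= e)%R].
  have : \forall s \near +oo%R, [/\ V s, (0 < s)%R & (k / e <= s)%R].
    near=> s; split; near: s; by [exact: FV|apply: nbhs_pinfty_gt; rewrite num_real
                                   |apply: nbhs_pinfty_ge; rewrite num_real].
  move=> /filter_ex[s [Vs s0 ks]]; exists s; split => //.
  by rewrite ler_pdivrMr// mulrC -ler_pdivrMr.
apply: (@le_trans _ _ (f s + e%:E)); last first.
  by rewrite leeD2r//; apply: ereal_sup_ubound; exists s.
apply: (@le_trans _ _ ((c - k / s)%:E + e%:E)); last by rewrite leeD2r// fge.
by rewrite -EFinD lee_fin -addrA lerDl addrC subr_ge0.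
Unshelve. all: by end_near. Qed.

Lemma limf_esup_le (f : R -> \bar R) (c k : R) :
  (forall s, (0 < s)%R -> f s <= (c + k / s)%:E) -> limf_esup f +oo%R <= c%:E.
Proof.
move=> fle; apply/lee_addgt0Pr => e e0.
apply: (@le_trans _ _ (ereal_sup [set f s | s in [set s | (0 < s /\ k / e <= s)%R]])).
  apply: ereal_inf_lbound; exists [set s | (0 < s /\ k / e <= s)%R] => //.
  near=> s; split; near: s; by [apply: nbhs_pinfty_gt; rewrite num_real
                                 |apply: nbhs_pinfty_ge; rewrite num_real].
apply: ub_ereal_sup => _ [s [s0 ks] <-].
rewrite (le_trans (fle s s0))// -EFinD lee_fin lerD2l.
by rewrite ler_pdivrMr// mulrC -ler_pdivrMr.
Unshelve. all: by end_near. Qed.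

End limf_esup_bounds.

Section average_age_bounds.
Local Open Scope ereal_scope.
Context (R : realType) (FX FS : probability R R) (Q : GGinf_queue FX FS).
Notation X := (interarrival Q).
Notation S := (service Q).
Variable m : R.
Hypothesis m_gt0 : (0 < m)%R.
Hypothesis mean_X : 'E_FX[fun x : R => x] = m%:E.

Lemma interarrival_law_gt0 : FX `]-oo, 0%R]%classic = 0.
Proof.
rewrite -(@interarrival_law _ _ _ Q 0%N)//=.
have [N [mN N0 subN]] := interarrival_gt0 Q.
have : qprob Q (X 0%N @^-1` `]-oo, 0%R]) <= qprob Q N.
  apply: le_measure; rewrite ?inE//.
    by rewrite -[X in measurable X]setTI; exact: measurable_funP.
  move=> w /=; rewrite in_itv/= => Xw; apply: subN => /= /(_ 0%N).
  by rewrite ltNge Xw.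
by rewrite N0 measure_le0 => /eqP.
Qed.

Lemma mean_norm_X : \int[FX]_x `|x|%:E = m%:E.
Proof.
rewrite -mean_X unlock; apply: ae_eq_integral => //.
- by apply/measurable_EFinP; exact: normr_measurable.
exists `]-oo, 0%R]%classic; split => //; first exact: interarrival_law_gt0.
move=> x /=; apply: contra_notP => /=.
rewrite in_itv/= => /negP; rewrite -ltNge => x0 _.
by rewrite gtr0_norm.
Qed.

Lemma ae_good : {ae qprob Q, forall w, (forall i, (0 < X i w)%R) /\
  (forall i, (0 <= S i w)%R)}.
Proof.
apply: filterS2 (interarrival_gt0 Q) (service_ge0 Q) => w; by split.
Qed.

Lemma expected_time_averaged_age_ge (s b k : R) : (0 < s)%R -> (0 <= b)%R ->
    \int[FX]_x (half_sqr_trunc b x)%:E = k%:E ->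
  (k / m - (k + b ^+ 2 / 2) / s)%:E <= \int[qprob Q]_w time_averaged_age (Q := Q) s w.
Proof.
move=> s0 b0 kE.
have [n] := expected_sqr_ge (interarrival_indep Q) (interarrival_law Q)
  b0 s0 m_gt0 mean_norm_X.
rewrite kE => len.
pose Y w := (\sum_(i < n) X i w ^+ 2 / 2 * \1_[set w | (epoch X i.+1 w <= s)%R] w)%R.
have Y0 w : (0 <= Y w)%R.
  by apply: sumr_ge0 => i _; rewrite mulr_ge0// divr_ge0// sqr_ge0.
have Y0E w : 0 <= (Y w)%:E by rewrite lee_fin.
have mY : measurable_fun [set: qspace Q] Y.
  apply: measurable_sum => i; apply: measurable_funM.
    exact: (measurableT_comp (@measurable_half_sqr R)).
  exact: (history_measurableW
    (@history_measurable_indic_epoch _ _ _ _ X i.+1 i.+1 s (leqnn _))).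
have is0 : (0 <= s^-1)%R by rewrite invr_ge0 ltW.
apply: (@le_trans _ _ (\int[qprob Q]_w ((s^-1)%:E * (Y w)%:E))); last first.
  apply: ae_integral_ge.
  - by apply: emeasurable_funM => //; exact/measurable_EFinP.
  - by move=> w; rewrite mule_ge0 ?lee_fin.
  apply: filterS ae_good => w [Xw Sw]; rewrite /time_averaged_age.
  by apply: lee_wpmul2l; [rewrite lee_fin|exact: integral_age_ge (ltW s0)].
rewrite ge0_integralZl_EFin//; last first.
  exact/measurable_EFinP.
have : ((s / m - 1) * k - b ^+ 2 / 2)%:E <= \int[qprob Q]_w (Y w)%:E.
  by rewrite EFinB leeBlDr// EFinM.
move=> /(lee_wpmul2l (_ : 0 <= (s^-1)%:E)) => /(_ is0); apply: le_trans.
rewrite -EFinM lee_fin le_eqVlt; apply/orP; left; apply/eqP; field.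
by rewrite !gt_eqF.
Qed.

(** The horizon tends to infinity at a fixed truncation level; monotone convergence then removes the
    truncation, also when E X^2 is infinite. *)
Lemma age_bound_le_average_age : age_bound FX <= average_age Q.
Proof.
pose k n := fine (\int[FX]_x (half_sqr_trunc n%:R x)%:E).
have kE n : \int[FX]_x (half_sqr_trunc n%:R x)%:E = (k n)%:E.
  rewrite fineK// ge0_fin_numE; last first.
    by apply: integral_ge0 => x _; rewrite lee_fin half_sqr_trunc_ge0.
  apply: (@le_lt_trans _ _ ((n%:R ^+ 2 / 2)%:E)); last exact: ltry.
  apply: integral_le_cst; first exact: measurable_half_sqr_trunc.
  by move=> x; rewrite half_sqr_trunc_ge0 half_sqr_trunc_le.
have kle n : (k n)%:E <= m%:E * average_age Q.
  have /(lee_wpmul2l (_ : 0 <= m%:E)) : (k n / m)%:E <= average_age Q.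
    apply: (@limf_esup_ge _ _ _ (k n + n%:R ^+ 2 / 2)) => s s0.
    exact: expected_time_averaged_age_ge.
  move=> /(_ (ltW m_gt0)); apply: le_trans.
  by rewrite -EFinM lee_fin mulrC divfK// gt_eqF.
have sup : \int[FX]_x (x ^+ 2 / 2)%R%:E <= m%:E * average_age Q.
  have : \int[FX]_x (half_sqr_trunc n%:R x)%:E @[n --> \oo] --> \int[FX]_x (x ^+ 2 / 2)%R%:E.
    have -> : \int[FX]_x (x ^+ 2 / 2)%R%:E =
        \int[FX]_x limn (fun n => (half_sqr_trunc n%:R x)%:E).
      apply: eq_integral => x _; apply/esym/cvg_lim => //.
      apply: cvg_near_cst; near=> n; rewrite /half_sqr_trunc ifT//.
      by near: n; exact: nbhs_infty_ger.
    apply: cvg_monotone_convergence => //.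
    - by move=> n; apply/measurable_EFinP; exact: measurable_half_sqr_trunc.
    - by move=> n x _; rewrite lee_fin half_sqr_trunc_ge0.
    - by move=> x _ i j ij; rewrite lee_fin half_sqr_trunc_nd// ler_nat.
  move=> sqr_cvg; rewrite -(cvg_lim _ sqr_cvg)//; apply: lime_le.
    by apply/cvg_ex; eexists; exact: sqr_cvg.
  by near=> n; rewrite kE.
rewrite /age_bound mean_X inver gt_eqF// muleA muleC lee_pdivrMl//.
apply: le_trans sup; rewrite unlock -ge0_integralZl//; last 2 first.
- by apply/measurable_EFinP; exact: measurable_funX.
- by move=> x _; rewrite lee_fin sqr_ge0.
rewrite le_eqVlt; apply/orP; left; apply/eqP.
by apply: eq_integral => x _; rewrite -EFinM mulrC.
Unshelve. all: by end_near. Qed.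

(** C is the bound on the mean area per interval; it is multiplied by the bound (s + b) / mb on the
    mean number of intervals and divided by s. *)
Lemma expected_time_averaged_age_le (s e b m2 mb C : R) :
    (0 < s)%R -> (0 <= e)%R -> (0 <= b)%R -> (0 < mb)%R ->
    \int[FX]_x (x ^+ 2)%:E = m2%:E ->
    \int[FX]_x (Num.min `|x|%R b)%:E = mb%:E ->
    (fine (FS `]e, +oo[%classic) < 1)%R ->
    C = (e * m + m2 / 2 + fine (FS `]e, +oo[%classic) /
      (1 - fine (FS `]e, +oo[%classic)) * m ^+ 2)%R ->
  \int[qprob Q]_w time_averaged_age (Q := Q) s w <=
  (C / mb + (e ^+ 2 / 2 + C * b / mb) / s)%:E.
Proof.
move=> s0 e0 b0 mb0 m2E mbE q1 CE.
pose c i (w : qspace Q) : R := (\1_[set w | (epoch X i w <= s)%R] w *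
  (e * `|X i w| + (X i w) ^+ 2 / 2 + `|X i w| * backlog X S e i w))%R.
have c0 i w : 0 <= (c i w)%:E.
  rewrite lee_fin mulr_ge0// addr_ge0//.
    by apply: addr_ge0; [exact: mulr_ge0|apply: divr_ge0 => //; exact: sqr_ge0].
  by rewrite mulr_ge0//; apply: sumr_ge0 => j _; rewrite mulr_ge0.
have mX i : measurable_fun [set: qspace Q] (X i) by exact: measurable_funP.
have mnX i : measurable_fun [set: qspace Q] (fun w => `|X i w|%R).
  by apply: measurableT_comp => //; exact: normr_measurable.
have mc i : measurable_fun [set: qspace Q] (fun w => (c i w)%:E).
  apply/measurable_EFinP; apply: measurable_funM.
    exact: (history_measurableW (@history_measurable_indic_epoch _ _ _ _ X i i s (leqnn _))).
  apply: measurable_funD.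
    apply: measurable_funD; first exact: measurable_funM.
    exact: (measurableT_comp (@measurable_half_sqr R) (mX i)).
  apply: measurable_funM => //; apply: measurable_sum => j.
  by apply: measurable_funM => //; apply: measurable_indic; exact: measurable_all_late.
have is0 : (0 <= s^-1)%R by rewrite invr_ge0 ltW.
have m_ge0 := ltW m_gt0.
pose U w := (s^-1)%:E * ((e ^+ 2 / 2)%:E + \sum_(i <oo) (c i w)%:E).
have ser0 w : 0 <= \sum_(i <oo) (c i w)%:E by apply: nneseries_ge0 => i _ _.
have mser : measurable_fun [set: qspace Q] (fun w => \sum_(i <oo) (c i w)%:E).
  by apply: ge0_emeasurable_sum => [i t _ _|i _].
have e2 : 0 <= (e ^+ 2 / 2)%:E :> \bar R by rewrite lee_fin divr_ge0// sqr_ge0.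
have V0 w : 0 <= (e ^+ 2 / 2)%:E + \sum_(i <oo) (c i w)%:E by exact: adde_ge0.
have mV : measurable_fun [set: qspace Q]
    (fun w => (e ^+ 2 / 2)%:E + \sum_(i <oo) (c i w)%:E).
  exact: emeasurable_funD.
apply: (@le_trans _ _ (\int[qprob Q]_w U w)).
  apply: ae_integral_le.
  - exact: emeasurable_funM.
  - by move=> w; rewrite mule_ge0.
  have := ae_epoch_unbounded (interarrival_indep Q) (interarrival_law Q) (ltW s0) b0 mb0 mbE.
  apply: filterS2 ae_good => w [Xw Sw] exn; rewrite /time_averaged_age.
  by apply: lee_wpmul2l; [rewrite lee_fin|exact: integral_age_le (ltW s0) e0 exn].
rewrite ge0_integralZl_EFin// ge0_integralD//=.
apply: (@le_trans _ _ ((s^-1)%:E * ((e ^+ 2 / 2)%:E + (C * ((s + b) / mb))%:E))).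
  apply: lee_wpmul2l; first by rewrite lee_fin.
  apply: leeD.
    by apply: integral_le_cst => // w; rewrite lexx andbT -lee_fin.
  rewrite integral_nneseries//; apply: lime_le.
    by apply: is_cvg_nneseries => i _ _; exact: integral_ge0.
  near=> n; rewrite big_mkord -ge0_integral_sum//.
  under eq_integral do rewrite sumEFin.
  have := expected_cycles_le (interarrival_indep Q) (interarrival_law Q)
    (service_indep Q) (service_law Q) (@interarrival_service_indep _ _ _ Q)
    n (ltW s0) e0 b0 m_ge0 mb0 mean_norm_X m2E mbE q1.
  by rewrite CE.
rewrite -EFinD -EFinM lee_fin le_eqVlt; apply/orP; left; apply/eqP; field.
by rewrite !gt_eqF.
Unshelve. all: by end_near. Qed.

(** With the cap b = n, the horizon tends to infinity first and leaves C / E min(X, n), which tends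
    to C / E X by monotone convergence. *)
Lemma average_age_le (e m2 : R) : (0 <= e)%R ->
    \int[FX]_x (x ^+ 2)%:E = m2%:E ->
    (fine (FS `]e, +oo[%classic) < 1)%R ->
  average_age Q <= (e + m2 / (2 * m) +
    fine (FS `]e, +oo[%classic) / (1 - fine (FS `]e, +oo[%classic)) * m)%:E.
Proof.
move=> e0 m2E q1; set q := fine _ in q1 *.
pose C := (e * m + m2 / 2 + q / (1 - q) * m ^+ 2)%R.
have mmin b : measurable_fun [set: R] (fun x : R => Num.min `|x|%R b).
  by apply: measurable_minr => //; exact: normr_measurable.
have min0 n (x : R) : (0 <= Num.min `|x|%R n%:R)%R by rewrite le_min normr_ge0 ler0n.
pose mb n := fine (\int[FX]_x (Num.min `|x|%R n%:R)%:E).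
have mbE n : \int[FX]_x (Num.min `|x|%R n%:R)%:E = (mb n)%:E.
  rewrite fineK// ge0_fin_numE; last by apply: integral_ge0 => x _; rewrite lee_fin.
  apply: (@le_lt_trans _ _ n%:R%:E); last exact: ltry.
  by apply: integral_le_cst => // x; rewrite min0 ge_min lexx orbT.
have mb_cvg : mb n @[n --> \oo] --> m.
  apply: fine_cvg; rewrite -mean_norm_X.
  have -> : \int[FX]_x `|x|%:E = \int[FX]_x limn (fun n => (Num.min `|x|%R n%:R)%:E).
    apply: eq_integral => x _; apply/esym/cvg_lim => //.
    apply: cvg_near_cst; near=> n; rewrite min_l//.
    by near: n; exact: nbhs_infty_ger.
  apply: cvg_monotone_convergence => //.
  - by move=> n; exact/measurable_EFinP.
  - move=> x _ i j ij; rewrite lee_fin le_min ge_min lexx/= ge_min.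
    by rewrite ler_nat ij orbT.
have Cmb_cvg : (C / mb n)%R @[n --> \oo] --> (C / m)%R.
  by apply: cvgM; [exact: cvg_cst|apply: cvgV => //; rewrite gt_eqF].
have -> : (e + m2 / (2 * m) + q / (1 - q) * m)%R = (C / m)%R.
  rewrite /C; field; rewrite !gt_eqF//= subr_gt0//.
apply/lee_addgt0Pr => d d0; rewrite -EFinD.
have [n [mbn0 Cn]] : exists n, (0 < mb n)%R /\ (C / mb n <= C / m + d)%R.
  have : \forall n \near \oo, (0 < mb n)%R /\ (C / mb n <= C / m + d)%R.
    near=> n; split; near: n.
      exact: (cvgr_gt m).
    by apply: (cvgr_le _ Cmb_cvg); rewrite ltrDl.
  exact: filter_ex.
apply: (@le_trans _ _ (C / mb n)%:E); last by rewrite lee_fin.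
apply: (@limf_esup_le _ _ _ (e ^+ 2 / 2 + C * n%:R / mb n)) => s s0.
exact: (@expected_time_averaged_age_le s e n%:R m2 (mb n) C).
Unshelve. all: by end_near. Qed.

End average_age_bounds.

(** * Convergence of the average age when the service tails vanish *)

Section asymptotics.
Context (R : realType) (FX : probability R R) (m : R).
Hypothesis m_gt0 : 0 < m.
Hypothesis mean_X : ('E_FX[fun x : R => x] = m%:E)%E.

Lemma average_age_cvg (F : set_system R) (FF : ProperFilter F)
    (FS : R -> probability R R) (Q : forall a, GGinf_queue FX (FS a)) :
    (forall e d : R, 0 < e -> 0 < d ->
      \forall a \near F, fine (FS a `]e, +oo[%classic) <= d) ->
  average_age (Q a) @[a --> F] --> age_bound FX.
Proof.
move=> tail.
have ge a : (age_bound FX <= average_age (Q a))%E.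
  exact: age_bound_le_average_age m_gt0 mean_X.
have sqr0 : (0 <= \int[FX]_x (x ^+ 2)%:E)%E.
  by apply: integral_ge0 => x _; rewrite lee_fin sqr_ge0.
have boundE : (age_bound FX = (2^-1)%:E * (\int[FX]_x (x ^+ 2)%:E * (m^-1)%:E))%E.
  by rewrite /age_bound mean_X inver gt_eqF// unlock.
(* If E X^2 is infinite, the lower bound alone forces both sides to be infinite. *)
have [sqroo|sqrfin] := eqVneq (\int[FX]_x (x ^+ 2)%:E)%E +oo%E.
  have booo : age_bound FX = +oo%E.
    by rewrite boundE sqroo gt0_mulye ?lte_fin ?invr_gt0// gt0_muley// lte_fin invr_gt0.
  rewrite booo; apply: cvg_near_cst; near=> a.
  by apply/eqP; rewrite -leye_eq -booo.
pose m2 := fine (\int[FX]_x (x ^+ 2)%:E)%E.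
have m2E : (\int[FX]_x (x ^+ 2)%:E = m2%:E)%E.
  by rewrite fineK// ge0_fin_numE// ltey.
pose A := m2 / (2 * m).
have AE : age_bound FX = A%:E.
  by rewrite boundE m2E -!EFinM /A; congr EFin; field; rewrite gt_eqF.
have le (d : R) : 0 < d -> \forall a \near F, (average_age (Q a) <= (A + d)%:E)%E.
  move=> d0.
  have d20 : 0 < d / 2 by rewrite divr_gt0.
  (* q <= 1/2 gives q / (1 - q) <= 2 q, and q <= d / (4 m) then makes the backlog term at most d /
     2; the other d / 2 is e. *)
  have d4m : 0 < Num.min (2^-1) (d / (4 * m)).
    by rewrite lt_min invr_gt0 ltr0n/= divr_gt0// mulr_gt0.
  near=> a.
  have : fine (FS a `]d / 2, +oo[%classic) <= Num.min (2^-1) (d / (4 * m)).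
    by near: a; exact: tail.
  set q := fine _; rewrite le_min => /andP[q2 qd].
  have q0 : 0 <= q by exact: fine_ge0.
  have q1 : q < 1 by rewrite (le_lt_trans q2)// invf_lt1 ?ltr1n.
  apply: le_trans (average_age_le (Q a) m_gt0 mean_X (ltW d20) m2E q1) _.
  rewrite -/q -/A lee_fin.
  have : q / (1 - q) <= 2 * q.
    rewrite ler_pdivrMr ?subr_gt0// -mulrA [X in _ <= X]mulrCA -[X in X <= _]mulr1 ler_wpM2l//.
    by rewrite mulrBr mulr1; move: q2; rewrite -[2^-1]div1r ler_pdivlMr//; lra.
  move=> /(ler_wpM2r (ltW m_gt0)).
  have : 2 * q * m <= d / 2.
    rewrite -[X in _ <= X](_ : 2 * (d / (4 * m)) * m = _); last by field; rewrite gt_eqF.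
    by rewrite ler_wpM2r ?(ltW m_gt0)// ler_wpM2l.
  by lra.
rewrite AE; apply/fine_cvgP.
have fin : \forall a \near F, average_age (Q a) \is a fin_num.
  near=> a; rewrite fin_numElt; apply/andP; split.
    by apply: lt_le_trans (ge a); rewrite AE ltNyr.
  have : (average_age (Q a) <= (A + 1)%:E)%E by near: a; exact: le.
  by move=> /le_lt_trans; apply; exact: ltry.
split => //; apply/cvgrPdist_le => d d0; near=> a.
have fa : average_age (Q a) \is a fin_num by near: a.
have := ge a; have : (average_age (Q a) <= (A + d)%:E)%E by near: a; exact: le.
rewrite AE -(fineK fa) !lee_fin /= => le1 le2.
by rewrite distrC ger0_norm ?subr_ge0// lerBlDl.
Unshelve. all: by end_near. Qed.

End asymptotics.

(** * Tails of the service distributions *)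

Section service_tails.
Context (R : realType).

Lemma tail_cdf (F : probability R R) (G : R -> R) (e : R) : has_cdf F G ->
  fine (F `]e, +oo[%classic) = 1 - G e.
Proof.
move=> FG; have -> : `]e, +oo[%classic = ~` `]-oo, e]%classic.
  by rewrite setCitvl.
by rewrite probability_setC// FG.
Qed.

(** The tail is (theta / e)^a, at most theta / e once theta <= e, and theta tends to 0 because 1 -
    1/a <= a - 1. Taking d' <= 1 secures theta <= e. *)
Lemma pareto_tail (mu e d : R) : 0 < mu -> 0 < e -> 0 < d ->
  \forall a \near 1^'+, 1 - pareto_cdf mu a e <= d.
Proof.
move=> mu0 e0 d0; pose d' := Num.min d 1.
have d'0 : 0 < d' by rewrite lt_min d0 ltr01.
have d'd : d' <= d by rewrite ge_min lexx.
have d'1 : d' <= 1 by rewrite ge_min lexx orbT.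
near=> a.
have a1 : 1 < a by near: a; exact: nbhs_right_gt.
have a0 : 0 < a by exact: lt_trans a1.
have ale : a <= 1 + mu * (d' * e).
  by near: a; apply: nbhs_right_le; rewrite ltrDl !mulr_gt0.
pose theta := mu^-1 * (1 - a^-1).
have th0 : 0 < theta by rewrite mulr_gt0 ?invr_gt0// subr_gt0 invf_lt1.
have thle : theta <= d' * e.
  rewrite /theta mulrC ler_pdivrMr// mulrC.
  apply: (@le_trans _ _ (a - 1)); last by rewrite lerBlDl.
  rewrite -subr_ge0 (_ : _ - _ = (a - 1) ^+ 2 / a); last by field; rewrite gt_eqF.
  by rewrite divr_ge0 ?sqr_ge0// ltW.
have the : theta <= e by rewrite (le_trans thle)// ger_pMl.
rewrite /pareto_cdf -/theta the opprB addrCA subrr addr0.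
apply: (@le_trans _ _ ((theta / e) `^ 1)).
  apply: ger_powR; last exact: ltW.
  by rewrite divr_gt0//= ler_pdivrMr// mul1r.
by rewrite powRr1 ?(ltW (divr_gt0 _ _))// (le_trans _ d'd)// ler_pdivrMr.
Unshelve. all: by end_near. Qed.

Lemma probability_tail (F : probability (measurableTypeR R) R) (d : R) : 0 < d ->
  exists K : R, (F `]K, +oo[%classic <= d%:E)%E.
Proof.
move=> d0.
have : F `]n%:R, +oo[%classic @[n --> \oo] --> F (\bigcap_n `]n%:R, +oo[%classic).
  apply: nonincreasing_cvg_mu => //.
  - by rewrite (le_lt_trans (probability_le1 _ _))// ltry.
  - exact: bigcapT_measurable.
  - move=> i j ij; apply/subsetPset => x /=; rewrite !in_itv/= !andbT.
    by apply: le_lt_trans; rewrite ler_nat.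
rewrite (_ : \bigcap_n _ = set0) ?measure0; last first.
  rewrite -subset0 => x /(_ (Num.truncn x).+1 I) /=; rewrite in_itv/= andbT.
  by rewrite ltNge ltW// truncnS_gt.
move=> /fine_cvgP[_] /cvgr_le /(_ _ d0) /filter_ex[n nd].
by exists n%:R; rewrite -lee_fin fineK// in nd; exact: fin_num_measure.
Qed.

(** S > e means N > sigma / 2 + (ln e + ln mu) / sigma. The two lower bounds on sigma make this
    threshold at least (K + 1) - 1 = K. *)
Lemma lognormal_tail (mu e d : R) (FS : R -> probability R R) :
    0 < mu -> 0 < e -> 0 < d ->
    (forall sigma : R, 0 < sigma -> is_lognormal (FS sigma) mu sigma) ->
  \forall sigma \near +oo%R, fine (FS sigma `]e, +oo[%classic) <= d.
Proof.
move=> mu0 e0 d0 logn.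
have [K Kd] := @probability_tail (normal_prob (0 : R) 1) _ d0.
near=> sigma.
have s0 : 0 < sigma by near: sigma; apply: nbhs_pinfty_gt; rewrite num_real.
have sK : 2 * (K + 1) <= sigma by near: sigma; apply: nbhs_pinfty_ge; rewrite num_real.
have se : - (ln e + ln mu) <= sigma by near: sigma; apply: nbhs_pinfty_ge; rewrite num_real.
rewrite -lee_fin fineK ?fin_num_measure//; apply: le_trans Kd.
rewrite logn//; apply: le_measure; rewrite ?inE//.
  have mf : measurable_fun [set: R] (fun n : R => expR (- ln mu - sigma ^+ 2 / 2 + sigma * n)).
    by apply: measurableT_comp => //; apply: measurable_funD.
  by rewrite -[X in measurable X]setTI; apply: (mf _ `]e, +oo[%classic).
move=> x /=; rewrite !in_itv/= !andbT => ex; rewrite ltNge; apply/negP => xK.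
move: ex; apply/negP; rewrite -leNgt -ler_ln ?posrE ?expR_gt0// expRK.
have : sigma * x <= sigma * K by rewrite ler_wpM2l// ltW.
have : sigma * (2 * (K + 1)) <= sigma * sigma by rewrite ler_wpM2l// ltW.
rewrite expr2; lra.
Unshelve. all: by end_near. Qed.

(** This is ln u <= u - 1 at u = t / (2 z); the majorant is a multiple of the exponential density of
    rate 1/2. *)
Lemma Gamma_integrand_bound (z t : R) : 0 < z -> 0 < t ->
  t `^ z * expR (- t) <= expR (z * (ln (2 * z) - 1)) * expR (- (2^-1 * t)).
Proof.
move=> z0 t0; rewrite /powR gt_eqF// -!expRD ler_expR.
have u0 : 0 < t / (2 * z) by rewrite divr_gt0// mulr_gt0.
have := le_ln1Dx (_ : -1 < t / (2 * z) - 1).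
rewrite addrCA subrr addr0 ltrBrDr addNr => /(_ u0).
rewrite ln_div ?posrE ?mulr_gt0// => /(ler_wpM2l (ltW z0)).
rewrite (_ : z * (t / (2 * z) - 1) = 2^-1 * t - z); last by field; rewrite gt_eqF.
lra.
Qed.

Lemma Gamma_ge (z M : R) : 0 < z -> 1 <= M ->
  M `^ z * expR (- (M + 1)) <= Gamma (1 + z).
Proof.
move=> z0 M1; have M0 : 0 < M by exact: lt_le_trans M1.
pose f (t : R) := t `^ z * expR (- t).
have f0 t : 0 <= f t by rewrite mulr_ge0 ?powR_ge0 ?expR_ge0.
have mf : measurable_fun [set: R] (EFin \o f).
  apply/measurable_EFinP; apply: measurable_funM; first exact: measurable_powR.
  by apply: measurableT_comp.
rewrite /Gamma addrAC subrr add0r /Rintegral -/f.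
(* [Gamma] is a real-valued integral, equal to 0 by default if the integral is infinite, so
   finiteness comes before the lower bound. *)
have fin : (\int[lebesgue_measure]_(t in `]0%R, +oo[) (f t)%:E < +oo)%E.
  pose C := expR (z * (ln (2 * z) - 1)) * 2.
  apply: (@le_lt_trans _ _
    (\int[lebesgue_measure]_(t in `]0%R, +oo[) (C%:E * (exponential_pdf 2^-1 t)%:E))%E).
    apply: ge0_le_integral => //.
    - by move=> t _; rewrite lee_fin.
    - exact: measurable_funTS.
    - apply: measurable_funTS; apply: emeasurable_funM => //.
      by apply/measurable_EFinP; exact: measurable_exponential_pdf.
    move=> t; rewrite /= in_itv/= andbT => t0; rewrite -EFinM lee_fin.
    rewrite (exponential_pdfE _ (ltW t0)) /C.
    rewrite -mulrA (mulrA 2) divff// mul1r mulNr.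
    exact: Gamma_integrand_bound.
  apply: (@le_lt_trans _ _ (\int[lebesgue_measure]_t (C%:E * (exponential_pdf 2^-1 t)%:E))%E).
    apply: ge0_subset_integral => //.
      apply: emeasurable_funM => //.
      by apply/measurable_EFinP; exact: measurable_exponential_pdf.
    by move=> t _; rewrite mule_ge0 ?lee_fin ?mulr_ge0 ?expR_ge0 ?exponential_pdf_ge0.
  rewrite ge0_integralZl_EFin//.
  - by rewrite integral_exponential_pdf ?mule1 ?ltry.
  - by move=> t _; rewrite lee_fin exponential_pdf_ge0.
  - by apply/measurable_EFinP; exact: measurable_exponential_pdf.
  - by rewrite mulr_ge0 ?expR_ge0.
have int0 : (0 <= \int[lebesgue_measure]_(t in `]0%R, +oo[) (f t)%:E)%E.
  by apply: integral_ge0 => t _; rewrite lee_fin.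
rewrite -lee_fin fineK ?ge0_fin_numE//.
apply: (@le_trans _ _ (\int[lebesgue_measure]_(t in `[M, (M + 1)%R]) (f t)%:E)%E); last first.
  apply: ge0_subset_integral => //.
  - exact: measurable_funTS.
  - by move=> t _; rewrite lee_fin.
  - by move=> t /=; rewrite !in_itv/= andbT => /andP[Mt _]; exact: lt_le_trans Mt.
apply: (@le_trans _ _
  (\int[lebesgue_measure]_(t in `[M, (M + 1)%R]) (M `^ z * expR (- (M + 1)))%:E)%E).
  rewrite integral_cst//= lebesgue_measure_itv/= lte_fin ltrDl ltr01.
  by rewrite -EFinB addrAC subrr add0r mule1.
apply: ge0_le_integral => //.
- by move=> t _; rewrite lee_fin mulr_ge0 ?powR_ge0 ?expR_ge0.
- exact: measurable_funTS.
move=> t; rewrite /= in_itv/= => /andP[Mt tM]; rewrite lee_fin ler_pM ?powR_ge0 ?expR_ge0//.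
  by rewrite ge0_ler_powR ?nnegrE ?(ltW z0) ?(ltW M0)// (le_trans _ Mt)// ltW.
by rewrite ler_expR lerN2.
Qed.

(** The tail is exp(-(e mu Gamma(1 + 1/k))^k). By [Gamma_ge] at z = 1/k the inner power is at least
    c^k M, and c^k tends to 1 as k tends to 0. *)
Lemma weibull_tail (mu e d : R) : 0 < mu -> 0 < e -> 0 < d ->
  \forall k \near 0^'+, 1 - weibull_cdf mu k e <= d.
Proof.
move=> mu0 e0 d0.
(* Chosen so that exp(-M / 2) <= d, with M >= 1 as [Gamma_ge] requires. *)
pose M := Num.max 1 (- (2 * ln d)).
have M1 : 1 <= M by rewrite le_max lexx.
have M0 : 0 < M by exact: lt_le_trans M1.
have Md : - (2 * ln d) <= M by rewrite le_max lexx orbT.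
pose c := e * mu * expR (- (M + 1)).
have c0 : 0 < c by rewrite !mulr_gt0 ?expR_gt0.
near=> k.
have k0 : 0 < k by near: k; exact: nbhs_right_gt.
(* This gives k |ln c| <= 1/2, hence c^k >= 1 + k ln c >= 1/2. *)
have kc : k <= (2 * (`|ln c| + 1))^-1.
  by near: k; apply: nbhs_right_le; rewrite invr_gt0 mulr_gt0// ltr_wpDl.
rewrite /weibull_cdf (ltW e0) opprB addrCA subrr addr0 invrK.
have Mc : M / 2 <= (e * (mu * Gamma (1 + k^-1))) `^ k.
  apply: (@le_trans _ _ ((c * M `^ k^-1) `^ k)); last first.
    apply: ge0_ler_powR; rewrite ?nnegrE ?(ltW k0)//.
    - by rewrite mulr_ge0 ?powR_ge0 ?(ltW c0).
    - rewrite mulr_ge0 ?(ltW e0)// mulr_ge0 ?(ltW mu0)//.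
      by rewrite /Gamma; apply: Rintegral_ge0 => t _; rewrite mulr_ge0 ?powR_ge0 ?expR_ge0.
    rewrite /c -!mulrA ler_wpM2l ?(ltW e0)// ler_wpM2l ?(ltW mu0)// mulrC.
    by apply: Gamma_ge => //; rewrite invr_gt0.
  rewrite powRM ?powR_ge0 ?(ltW c0)// -powRrM mulVf ?gt_eqF// powRr1 ?(ltW M0)//.
  rewrite mulrC ler_wpM2r ?(ltW M0)// /powR gt_eqF//.
  apply: le_trans (expR_ge1Dx _).
  have : k * `|ln c| <= 2^-1.
    apply: (@le_trans _ _ ((2 * (`|ln c| + 1))^-1 * `|ln c|)); first by rewrite ler_wpM2r.
    rewrite mulrC ler_pdivrMr ?mulr_gt0 ?ltr_wpDl// mulrA mulVf// mul1r lerDl.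
    exact: ler01.
  have : - (k * `|ln c|) <= k * ln c.
    by rewrite -mulrN ler_wpM2l ?(ltW k0)// lerNl -normrN ler_norm.
  lra.
rewrite -[leRHS]lnK ?posrE// ler_expR.
lra.
Unshelve. all: by end_near. Qed.

End service_tails.
Theorem theorem6 (R : realType) (FX : probability R R) (lambda mu : R)
    (lambda_gt0 : 0 < lambda) (lambda_lt_mu : lambda < mu)
    (mean_X : ('E_FX[fun x : R => x] = (lambda^-1)%:E)%E) :
  (forall (FS : probability R R) (Q : GGinf_queue FX FS),
     ('E_FS[fun s : R => s] = (mu^-1)%:E)%E ->
     (age_bound FX <= average_age Q)%E) /\
  (forall (FS : R -> probability R R)
          (Q : forall alpha : R, GGinf_queue FX (FS alpha)),
     (forall alpha : R, 1 < alpha -> has_cdf (FS alpha) (pareto_cdf mu alpha)) ->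
     average_age (Q alpha) @[alpha --> 1^'+] --> age_bound FX) /\
  (forall (FS : R -> probability R R)
          (Q : forall sigma : R, GGinf_queue FX (FS sigma)),
     (forall sigma : R, 0 < sigma -> is_lognormal (FS sigma) mu sigma) ->
     average_age (Q sigma) @[sigma --> +oo%R] --> age_bound FX) /\
  (forall (FS : R -> probability R R)
          (Q : forall kappa : R, GGinf_queue FX (FS kappa)),
     (forall kappa : R, 0 < kappa -> has_cdf (FS kappa) (weibull_cdf mu kappa)) ->
     average_age (Q kappa) @[kappa --> 0^'+] --> age_bound FX).
Proof.
have m_gt0 : 0 < lambda^-1 by rewrite invr_gt0.
have mu_gt0 : 0 < mu by exact: lt_trans lambda_lt_mu.
split; [|split; [|split]] => [FS Q _|FS Q cdf|FS Q law|FS Q cdf].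
- exact: age_bound_le_average_age m_gt0 mean_X.
- apply: (average_age_cvg m_gt0 mean_X) => e d e0 d0; near=> alpha.
  have alpha1 : 1 < alpha by near: alpha; exact: nbhs_right_gt.
  rewrite (tail_cdf e (cdf _ alpha1)).
  by near: alpha; exact: pareto_tail.
- apply: (average_age_cvg m_gt0 mean_X) => e d e0 d0.
  exact: (lognormal_tail mu_gt0 e0 d0 law).
- apply: (average_age_cvg m_gt0 mean_X) => e d e0 d0; near=> kappa.
  have kappa0 : 0 < kappa by near: kappa; exact: nbhs_right_gt.
  rewrite (tail_cdf e (cdf _ kappa0)).
  by near: kappa; exact: weibull_tail.
Unshelve. all: by end_near. Qed.
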